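(* Let $d\geq 2$, let $T_d$ be the $d$-regular rooted tree, and let $G\leq\operatorname{Aut}(T_d)$ be a finitely generated self-similar branch group with the subgroup induction property and such that $\Phi_F(G)$ is non-trivial. Let $H$ be a group commensurable with a finitely generated subgroup of $G$. Then all maximal subgroups of $H$ are of finite index in $H$.
   Context: $\Phi_F(G)$ denotes the intersection of all maximal subgroups of finite index of $G$. Two groups $G_1,G_2$ are commensurable if there are finite-index subgroups $H_i\leq G_i$ with $H_1\cong H_2$. The vertices of the $d$-regular rooted tree $T=T_d$ are identified with the words in $\{1,\dots,d\}^*$; the root is the empty word, the children of $v$ are $v1,\dots,vd$, and $\mathcal L_n$ is the set of words of length $n$. $\operatorname{Aut}(T)$ is the group of automorphisms of $T$ (fixing the root). For a vertex $v$, $T_v$ is the subtree of all words with prefix $v$. For $g\in\operatorname{Aut}(T)$ and a vertex $v$, the section $\varphi_v(g)\in\operatorname{Aut}(T)$ is the unique automorphism with $g\cdot(vw)=(g\cdot v)(\varphi_v(g)\cdot w)$ for all $w\in T$; $\varphi_v$ is a homomorphism on the stabilizer of $v$. For $G\leq\operatorname{Aut}(T)$ and a set $V$ of vertices, $\operatorname{Stab}_G(V)$ is the pointwise stabilizer of $V$ in $G$. $\operatorname{Rist}_G(v)$ is the subgroup of elements of $G$ acting trivially outside $T_v$, and $\operatorname{Rist}_G(\mathcal L_n)$ is the subgroup generated by all $\operatorname{Rist}_G(v)$, $v\in\mathcal L_n$. $G$ is branch if it acts transitively on every $\mathcal L_n$, all $\operatorname{Rist}_G(v)$ are infinite, and every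 $\operatorname{Rist}_G(\mathcal L_n)$ has finite index in $G$. $G$ is self-similar if $\varphi_v(G)\leq G$ for all vertices $v$. Let $G$ be self-similar. A class $\mathcal X$ of subgroups of $G$ is inductive if: (A) $\{1\}\in\mathcal X$ and $G\in\mathcal X$; (B) if $H\leq L$ are subgroups of $G$ with $[L:H]$ finite and $H\in\mathcal X$, then $L\in\mathcal X$; (C) if $H$ is a finitely generated subgroup of $\operatorname{Stab}_G(\mathcal L_1)$ and $\varphi_v(H)\in\mathcal X$ for all $v\in\mathcal L_1$, then $H\in\mathcal X$. $G$ has the subgroup induction property if every inductive class of subgroups of $G$ contains every finitely generated subgroup of $G$. *)

(* Defs.v *)
From HB Require Import structures.
From mathcomp Require Import all_boot all_classical.

Set Implicit Arguments.
Unset Strict Implicit.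
Unset Printing Implicit Defensive.

Local Open Scope classical_set_scope.
Local Open Scope group_scope.

(* A groupType carries a choiceType structure; by gen_eqMixin and
   gen_choiceMixin every type has one, so no group is excluded. *)
Section Groups.
Variable gT : groupType.
Implicit Types A B K L M S : set gT.

Definition is_subgroup A :=
  [/\ A 1, forall x y, A x -> A y -> A (x * y) & forall x, A x -> A x^-1].

Definition subgroup_of A B := is_subgroup A /\ A `<=` B.

Definition left_coset A (x : gT) : set gT := [set x * a | a in A].

(* Meant for subgroups A of B. *)
Definition finite_index A B := finite_set [set left_coset A x | x in B].

Definition generated S : set gT := smallest is_subgroup S.

Definition finitely_generated A :=
  exists2 S : set gT, finite_set S & A = generated S.

Definition maximal_subgroup M A :=
  [/\ subgroup_of M A, M <> A &
      forall K, is_subgroup K -> M `<=` K -> K `<=` A -> K = M \/ K = A].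

(* Phi_F(A).  The intersection is taken inside A, so that it is A when A has no
   maximal subgroup of finite index. *)
Definition frattini_fi A : set gT :=
  A `&` \bigcap_(M in [set M | maximal_subgroup M A /\ finite_index M A]) M.

End Groups.

(* The values of f outside A are irrelevant. *)
Definition isomorphic_groups (gT hT : groupType) (A : set gT) (B : set hT) :=
  exists f : gT -> hT,
    set_bij A B f /\ forall x y, A x -> A y -> f (x * y) = f x * f y.

Definition commensurable (gT hT : groupType) (A : set gT) (B : set hT) :=
  exists A1 : set gT, exists B1 : set hT,
    [/\ subgroup_of A1 A /\ finite_index A1 A,
        subgroup_of B1 B /\ finite_index B1 B &
        isomorphic_groups A1 B1].

Section Tree.
Variable d : nat.

Definition vertex := seq 'I_d.
Implicit Types u v w : vertex.

Definition is_child v u := [exists x : 'I_d, v == rcons u x].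

Definition adjacent u v := is_child u v || is_child v u.

Definition is_tree_aut (f : vertex -> vertex) :=
  [/\ bijective f, f [::] = [::] &
      forall u v, adjacent (f u) (f v) = adjacent u v].

Record tree_aut := TreeAut {
  tree_aut_fun :> vertex -> vertex;
  tree_autP : is_tree_aut tree_aut_fun }.

Lemma tree_aut_ext (f g : tree_aut) : tree_aut_fun f =1 tree_aut_fun g -> f = g.
Proof.
case: f g => [f pf] [g pg] /= /funext efg.
by case: _ / efg pg => pg; congr TreeAut; apply: Prop_irrelevance.
Qed.

Lemma is_tree_aut_id : is_tree_aut id.
Proof. by split=> //; exists id. Qed.

Lemma is_tree_aut_comp f g :
  is_tree_aut f -> is_tree_aut g -> is_tree_aut (f \o g).
Proof.
case=> bf f0 fA [bg g0 gA]; split=> [||u v] /=; first exact: bij_comp.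
  by rewrite g0 f0.
by rewrite fA gA.
Qed.

Lemma is_tree_aut_can f g :
  is_tree_aut f -> cancel f g -> cancel g f -> is_tree_aut g.
Proof.
case=> _ f0 fA fK gK; split=> [||u v]; first by exists f.
  by rewrite -[RHS]fK f0.
by rewrite -fA !gK.
Qed.

Lemma tree_aut_inv_ex (f : tree_aut) :
  exists g : tree_aut, cancel (tree_aut_fun f) g /\ cancel (tree_aut_fun g) f.
Proof.
case: (tree_autP f) => -[g fK gK] _ _.
by exists (TreeAut (is_tree_aut_can (tree_autP f) fK gK)).
Qed.

Definition tree_aut_one : tree_aut := TreeAut is_tree_aut_id.
(* Left action: (f * g) v = f (g v). *)
Definition tree_aut_mul (f g : tree_aut) : tree_aut :=
  TreeAut (is_tree_aut_comp (tree_autP f) (tree_autP g)).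
Definition tree_aut_inv (f : tree_aut) : tree_aut :=
  projT1 (cid (tree_aut_inv_ex f)).

Lemma tree_aut_invK (f : tree_aut) :
  cancel (tree_aut_fun f) (tree_aut_inv f) /\ cancel (tree_aut_fun (tree_aut_inv f)) f.
Proof. exact: projT2 (cid (tree_aut_inv_ex f)). Qed.

Lemma tree_aut_mulA : associative tree_aut_mul.
Proof. by move=> f g h; apply: tree_aut_ext. Qed.
Lemma tree_aut_mul1 : left_id tree_aut_one tree_aut_mul.
Proof. by move=> f; apply: tree_aut_ext. Qed.
Lemma tree_aut_mulr1 : right_id tree_aut_one tree_aut_mul.
Proof. by move=> f; apply: tree_aut_ext. Qed.
Lemma tree_aut_mulV : left_inverse tree_aut_one tree_aut_inv tree_aut_mul.
Proof. by move=> f; apply: tree_aut_ext => v /=; case: (tree_aut_invK f). Qed.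
Lemma tree_aut_mulrV : right_inverse tree_aut_one tree_aut_inv tree_aut_mul.
Proof. by move=> f; apply: tree_aut_ext => v /=; case: (tree_aut_invK f). Qed.

HB.instance Definition _ := gen_eqMixin tree_aut.
HB.instance Definition _ := gen_choiceMixin tree_aut.
HB.instance Definition _ := isGroup.Build tree_aut
  tree_aut_mulA tree_aut_mul1 tree_aut_mulr1 tree_aut_mulV tree_aut_mulrV.

Lemma tree_aut_mulE (f g : tree_aut) v : (f * g) v = f (g v).
Proof. by []. Qed.
Lemma tree_aut_1E v : (1 : tree_aut) v = v.
Proof. by []. Qed.

Lemma tree_aut_rcons (f : tree_aut) u x : exists y, f (rcons u x) = rcons (f u) y.
Proof.
case: (tree_autP f) => -[g fK _] f0 fA.
elim/last_ind: u x => [|u y IH] x.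
  have: adjacent (f [::]) (f [:: x]).
    by rewrite fA; apply/orP; right; apply/existsP; exists x.
  rewrite f0 => /orP[/existsP[y /eqP e]|/existsP[y /eqP ->]]; last by exists y.
  by have := congr1 size e; rewrite size_rcons.
have: adjacent (f (rcons u y)) (f (rcons (rcons u y) x)).
  by rewrite fA; apply/orP; right; apply/existsP; exists x.
case/orP=> [/existsP[z /eqP e]|/existsP[z /eqP ->]]; last by exists z.
have [t et] := IH y; move: e; rewrite et => /rcons_inj[/(can_inj fK) e _].
by have /eqP := congr1 size e; rewrite !size_rcons -[X in X == _]addn0 -addn2 eqn_add2l.
Qed.

Lemma tree_aut_size (f : tree_aut) v : size (f v) = size v.
Proof.
elim/last_ind: v => [|v x IH]; first by case: (tree_autP f) => _ ->.
by have [y ->] := tree_aut_rcons f v x; rewrite !size_rcons IH.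
Qed.

Definition section_fun v (g : tree_aut) w : vertex := drop (size v) (g (v ++ w)).

Lemma section_funE v (g : tree_aut) w : g (v ++ w) = g v ++ section_fun v g w.
Proof.
suff [w' e] : exists w', g (v ++ w) = g v ++ w'.
  by rewrite /section_fun e -(tree_aut_size g) drop_size_cat.
elim/last_ind: w => [|w x [w' IH]]; first by exists [::]; rewrite !cats0.
rewrite -rcons_cat; have [y ->] := tree_aut_rcons g (v ++ w) x.
by exists (rcons w' y); rewrite IH rcons_cat.
Qed.

Lemma adjacent_cat v u w : adjacent (v ++ u) (v ++ w) = adjacent u w.
Proof.
have E a b : is_child (v ++ a) (v ++ b) = is_child a b.
  by apply: eq_existsb => x; rewrite rcons_cat eqseq_cat // eqxx.
by rewrite /adjacent !E.
Qed.

Lemma section_is_tree_aut v (g : tree_aut) : is_tree_aut (section_fun v g).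
Proof.
have [gK gK'] := tree_aut_invK g.
split=> [||u w].
- exists (section_fun (g v) (tree_aut_inv g)) => w.
    by rewrite {1}/section_fun -section_funE gK tree_aut_size drop_size_cat.
  rewrite {1}/section_fun -{2}[v]gK -section_funE gK'.
  by rewrite -(tree_aut_size g) drop_size_cat.
- by rewrite /section_fun cats0 drop_oversize // tree_aut_size.
- by rewrite -(adjacent_cat (g v)) -!section_funE -(adjacent_cat v u);
    case: (tree_autP g).
Qed.

(* The section of g at v; tree_sectionP and tree_section_uniq show that it is
   the unique automorphism s with g (v ++ w) = g v ++ s w. *)
Definition tree_section v (g : tree_aut) : tree_aut :=
  TreeAut (section_is_tree_aut v g).

Lemma tree_sectionP v (g : tree_aut) w : g (v ++ w) = g v ++ tree_section v g w.
Proof. exact: section_funE. Qed.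

Lemma tree_section_uniq v (g s : tree_aut) :
  (forall w, g (v ++ w) = g v ++ s w) -> s = tree_section v g.
Proof.
move=> sP; apply: tree_aut_ext => w; have := sP w.
by rewrite tree_sectionP => /eqP; rewrite eqseq_cat // eqxx => /eqP.
Qed.

Definition level n : set vertex := [set v | size v = n].

Implicit Types G H L : set tree_aut.

Definition pstab G (V : set vertex) : set tree_aut :=
  [set g | G g /\ forall v, V v -> g v = v].

Definition rist G v : set tree_aut :=
  [set g | G g /\ forall w, ~~ prefix v w -> g w = w].

Definition rist_level G n : set tree_aut :=
  generated (\bigcup_(v in level n) rist G v).

Definition level_transitive G :=
  forall n u v, level n u -> level n v -> exists2 g, G g & g u = v.

Definition branch G :=
  [/\ level_transitive G,
      forall v, infinite_set (rist G v) &
      forall n, finite_index (rist_level G n) G].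

Definition self_similar G := forall v, tree_section v @` G `<=` G.

Definition inductive_class G (X : set (set tree_aut)) :=
  [/\ forall H, X H -> subgroup_of H G,
      X [set 1] /\ X G,
      forall H L, subgroup_of H L -> subgroup_of L G ->
        finite_index H L -> X H -> X L &
      forall H, finitely_generated H -> subgroup_of H (pstab G (level 1%N)) ->
        (forall v, level 1%N v -> X (tree_section v @` H)) -> X H].

Definition subgroup_induction_property G :=
  forall X, inductive_class G X ->
  forall H, finitely_generated H -> subgroup_of H G -> X H.

End Tree.

(* Main.v *)
From mathcomp Require Import all_boot all_fingroup all_solvable all_classical.
Require Import Defs.

(** Call a subset of G closed when it is closed for the profinite topology of G. The
theorem rests on four facts about G.

Every element of G has finite order. Being torsion, or containing for every n >
0 two elements whose n-th powers do not commute, is an inductive property; a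
cyclic group can only have it by being finite. Hence a finitely generated
subgroup has finite abelianisation, and the derived subgroup of a subgroup of
finite index again has finite index.

Nontrivial normal subgroups of G have finite index. If n in N moves a vertex w,
then N contains all commutators of elements of the rigid stabiliser of w that
normalise N; for N normal in G this holds at every vertex of a level, so N
contains the derived subgroup of a rigid level stabiliser. In particular
Phi_F(G) has finite index.

Finitely generated subgroups of G are closed. Closedness of the sections of H is
not enough to show that H is closed, as H is only a subdirect product of its
sections. The inductive property to use is that every normal subgroup N of every
finite-index subgroup H0 of H is closed (normal_subgroups_closed). Its induction
step, sections_match_closed, adds the coordinates one at a time: the elements of
N that are trivial on the earlier coordinates project to a normal subgroup of a
section of H0, closed by hypothesis, and what remains is a question modulo a
subgroup of finite index in N. That G itself has the property (normal_closed) is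
the branch structure: up to finite index, a normal subgroup of a finite-index
subgroup is the product of the derived rigid stabilisers of the vertices of some
level below which it acts nontrivially.

Phi_F(G) has nilpotent images in the finite quotients of G, since the Frattini
subgroup of a finite group is nilpotent. In a nilpotent group K a subgroup P
with P [K, K] = K is K itself.

Let now K be a finitely generated subgroup of Phi_F(G) and P < K a proper
subgroup. If P [K, K] = K then finitely many elements of P generate some L with
L [K, K] = K; by nilpotency L and K have the same image in every finite quotient
of G, and L is closed, so L = K, which is absurd. Thus P [K, K] is a proper
subgroup of K, of finite index because K is finitely generated and torsion: no
proper subgroup of K is profinitely dense. If a finite-index subgroup of H has
this property then the maximal subgroups of H have finite index
(fin_index_overgroup_maximal). A group commensurable with a finitely generated
subgroup of G has a finite-index subgroup isomorphic to such a K, namely to the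
intersection of Phi_F(G) with a finite-index subgroup of the given one. *)

Set Implicit Arguments.
Unset Strict Implicit.
Unset Printing Implicit Defensive.

Local Open Scope classical_set_scope.
Local Open Scope group_scope.

Ltac group_word :=
  rewrite ?(invMg, invgK, invg1, mulgA, mulgK, mulgVK, mulg1, mul1g, mulVg, mulgV) //.

Section AbstractGroups.
Variable gT : groupType.
Implicit Types (A B C D G K L M N P S U : set gT) (x y : gT).

(** * Subgroups *)

Lemma subgroup1 A : is_subgroup A -> A 1. Proof. by case. Qed.
Lemma subgroupM A x y : is_subgroup A -> A x -> A y -> A (x * y).
Proof. by case=> _ AM _; apply: AM. Qed.
Lemma subgroupV A x : is_subgroup A -> A x -> A x^-1.
Proof. by case=> _ _; apply. Qed.

Lemma subgroupX A x n : is_subgroup A -> A x -> A (x ^+ n).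
Proof.
move=> gA Ax; elim: n => [|n IH]; first exact: subgroup1.
by rewrite expgS; apply: subgroupM.
Qed.

Lemma subgroupI A B : is_subgroup A -> is_subgroup B -> is_subgroup (A `&` B).
Proof.
move=> [A1 AM AV] [B1 BM BV]; split=> [|x y [Ax Bx] [Ay By]|x [Ax Bx]].
- by [].
- by split; [apply: AM|apply: BM].
- by split; [apply: AV|apply: BV].
Qed.

Lemma generated_subgroup S : is_subgroup (generated S).
Proof.
split=> [A [gA _]|x y Sx Sy A [gA SA]|x Sx A [gA SA]].
- exact: subgroup1.
- by apply: subgroupM => //; [apply: Sx|apply: Sy].
- by apply: subgroupV => //; apply: Sx.
Qed.

Lemma generated_sub S A : is_subgroup A -> S `<=` A -> generated S `<=` A.
Proof. by move=> gA SA x; apply. Qed.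

Lemma mem_generated S : S `<=` generated S.
Proof. by move=> x Sx A [_]; apply. Qed.

Lemma finitely_generated_seq K : finitely_generated K ->
  exists s : seq gT, K = generated [set` s].
Proof. by case=> S /finite_seqP[s ->] ->; exists s. Qed.

Lemma cycle_finitely_generated x :
  finitely_generated (generated [set x]).
Proof. by exists [set x]; [exact: finite_set1|]. Qed.

Definition normalized N K := forall x y, K x -> N y -> N (x * y * x^-1).

Lemma conjVx N K x y : is_subgroup K -> normalized N K -> K x -> N y ->
  N (x^-1 * y * x).
Proof.
by move=> gK nNK Kx Ny; rewrite -{2}[x]invgK; apply: nNK => //; apply: subgroupV.
Qed.

Lemma normalized_sub N K L : L `<=` K -> normalized N K -> normalized N L.
Proof. by move=> LK nNK x y /LK; apply: nNK. Qed.

Lemma normalizedI N M K : normalized N K -> normalized M K -> normalized (N `&` M) K.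
Proof. by move=> nN nM x y Kx [Ny My]; split; [apply: nN|apply: nM]. Qed.

Lemma normalized_generated S K : normalized S K -> normalized (generated S) K.
Proof.
move=> nS x y Kx Sy; have gS := generated_subgroup S.
suff : [set y | generated S (x * y * x^-1)] y by [].
apply: (Sy [set y | generated S (x * y * x^-1)]); split=> [|z Sz]; last first.
  by apply: mem_generated; apply: nS.
split=> [|a b Sa Sb|a Sa] /=.
- by group_word; apply: (subgroup1 gS).
- have -> : x * (a * b) * x^-1 = (x * a * x^-1) * (x * b * x^-1) by group_word.
  exact: (subgroupM gS).
- have -> : x * a^-1 * x^-1 = (x * a * x^-1)^-1 by group_word.
  exact: (subgroupV gS).
Qed.

Definition prod_set P N := [set x | exists2 p, P p & N (p^-1 * x)].

Lemma prod_set_subgroup P N : is_subgroup P -> is_subgroup N -> normalized N P ->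
  is_subgroup (prod_set P N).
Proof.
move=> gP gN nNP; split.
- by exists 1; [apply: subgroup1|group_word; apply: subgroup1].
- move=> x y [p Pp Np] [q Pq Nq]; exists (p * q); first exact: subgroupM.
  have -> : (p * q)^-1 * (x * y) = q^-1 * (p^-1 * x) * q * (q^-1 * y) by group_word.
  by apply: subgroupM => //; apply: conjVx Pq Np.
- move=> x [p Pp Np]; exists p^-1; first exact: subgroupV.
  have -> : p^-1^-1 * x^-1 = p * (p^-1 * x)^-1 * p^-1 by group_word.
  by apply: nNP => //; apply: subgroupV.
Qed.

Lemma prod_set_subl P N : is_subgroup N -> P `<=` prod_set P N.
Proof. by move=> gN x Px; exists x => //; group_word; apply: subgroup1. Qed.

Lemma prod_set_subr P N : is_subgroup P -> N `<=` prod_set P N.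
Proof. by move=> gP x Nx; exists 1; [apply: subgroup1|group_word]. Qed.

Lemma prod_set_sub P N K : is_subgroup K -> P `<=` K -> N `<=` K -> prod_set P N `<=` K.
Proof.
move=> gK PK NK x [p Pp Np]; have -> : x = p * (p^-1 * x) by group_word.
by apply: subgroupM; auto.
Qed.

Lemma normalized_prod_set P N K : normalized P K -> normalized N K ->
  normalized (prod_set P N) K.
Proof.
move=> nP nN x y Kx [p Pp Np]; exists (x * p * x^-1); first exact: nP.
have -> : (x * p * x^-1)^-1 * (x * y * x^-1) = x * (p^-1 * y) * x^-1 by group_word.
exact: nN.
Qed.

(** The hypothesis makes f a homomorphism on A only, as for a section map on the
stabiliser of its vertex. *)
Lemma partial_hom1 (hT : groupType) (f : gT -> hT) A :
  is_subgroup A -> (forall x y : gT, A x -> A y -> f (x * y) = f x * f y) -> f 1 = 1.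
Proof.
move=> gA fM; apply: (@mulgI _ (f 1)).
by rewrite mulg1 -fM ?mulg1 //; apply: subgroup1.
Qed.

Lemma partial_homV (hT : groupType) (f : gT -> hT) A x :
  is_subgroup A -> (forall x y : gT, A x -> A y -> f (x * y) = f x * f y) ->
  A x -> f x^-1 = (f x)^-1.
Proof.
move=> gA fM Ax; have AxV := subgroupV gA Ax.
by apply/esym/mulg1_eq; rewrite -fM // mulgV (partial_hom1 gA fM).
Qed.

Lemma image_subgroup (hT : groupType) (f : gT -> hT) A : is_subgroup A ->
  (forall x y : gT, A x -> A y -> f (x * y) = f x * f y) -> is_subgroup (f @` A).
Proof.
move=> gA fM.
split=> [|_ _ [x Ax <-] [y Ay <-]|_ [x Ax <-]].
- by exists 1; [apply: subgroup1|apply: partial_hom1 fM].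
- by exists (x * y); [apply: subgroupM|rewrite fM].
- exists x^-1; first exact: subgroupV.
  exact: (partial_homV gA fM).
Qed.

(** * Finite index *)

(** A finite colouring of B whose fibres lie in left cosets of A.  Intersections,
restrictions and preimages of such pairs (A, B) are then a matter of combining or
composing colourings, with no choice of representatives. *)
Definition fin_index A B := exists (I : finType) (F : gT -> I),
  forall x y, B x -> B y -> F x = F y -> A (x^-1 * y).

Lemma fin_index_reps A B : fin_index A B -> exists s : seq gT,
  (forall t, t \in s -> B t) /\
  (forall b, B b -> exists2 t, t \in s & A (t^-1 * b)).
Proof.
case=> I [F FA].
pose r i := xget 1 [set b | B b /\ F b = i].
pose ok i := `[< exists2 b, B b & F b = i >].
have rP i : ok i -> B (r i) /\ F (r i) = i.
  by move/asboolP=> [b Bb Fb]; rewrite /r; case: xgetP => [c -> //|/(_ b)]; case.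
exists [seq r i | i <- enum I & ok i]; split.
  by move=> t /mapP[i]; rewrite mem_filter => /andP[/rP[]] + _ _ ->.
move=> b Bb; have okb : ok (F b) by apply/asboolP; exists b.
exists (r (F b)); first by apply: map_f; rewrite mem_filter okb mem_enum.
by have [Br Fr] := rP _ okb; apply: FA.
Qed.

Lemma reps_fin_index A B (s : seq gT) : is_subgroup A ->
  (forall b, B b -> exists2 t, t \in s & A (t^-1 * b)) -> fin_index A B.
Proof.
move=> gA sP; pose i b := find (fun t => `[< A (t^-1 * b) >]) s.
(* find takes the value size s when it fails *)
exists 'I_(size s).+1, (fun b => inord (i b)) => x y Bx By.
have iP b : B b -> A ((nth 1 s (i b))^-1 * b) /\ i b < (size s).+1.
  move=> Bb; split; last by rewrite ltnS find_size.
  apply/asboolP; apply: (nth_find 1 (a := fun t => `[< A (t^-1 * b) >])).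
  by apply/hasP; have [t ts At] := sP b Bb; exists t => //; apply/asboolP.
move/(congr1 (@nat_of_ord _)); have [Ax ix] := iP x Bx; have [Ay iy] := iP y By.
rewrite !inordK // => e; rewrite -e in Ay.
have -> : x^-1 * y = ((nth 1 s (i x))^-1 * x)^-1 * ((nth 1 s (i x))^-1 * y).
  by group_word.
by apply: subgroupM => //; apply: subgroupV.
Qed.

Lemma left_coset_eq A x y : is_subgroup A -> A (x^-1 * y) ->
  left_coset A x = left_coset A y.
Proof.
move=> gA Axy; apply/seteqP; split=> _ [a Aa <-].
  exists ((x^-1 * y)^-1 * a); last by group_word.
  by apply: subgroupM => //; apply: subgroupV.
by exists (x^-1 * y * a); [apply: subgroupM|group_word].
Qed.

Lemma finite_indexP A B : is_subgroup A -> finite_index A B <-> fin_index A B.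
Proof.
move=> gA; split.
  move=> /finite_seqP[s es].
  exists 'I_(size s).+1, (fun b => inord (index (left_coset A b) s)) => x y Bx By.
  have ms b : B b -> left_coset A b \in s.
    move=> Bb; have : [set left_coset A x | x in B] (left_coset A b) by exists b.
    by rewrite es.
  move/(congr1 (@nat_of_ord _)); rewrite !inordK ?ltnS ?index_size //.
  move/(congr1 (nth set0 s)); rewrite !nth_index ?ms // => e.
  have : left_coset A y y by exists 1; [apply: subgroup1|rewrite mulg1].
  by rewrite -e => -[a Aa <-]; rewrite mulKg.
move=> /fin_index_reps[s [sB sP]].
apply: (@sub_finite_set _ _ (left_coset A @` [set` s])).
  move=> _ [b Bb <-]; have [t ts At] := sP b Bb.
  by exists t => //; apply: left_coset_eq.
exact/finite_image/finite_seq.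
Qed.

Lemma fin_index_sub A A' B B' : A `<=` A' -> B' `<=` B ->
  fin_index A B -> fin_index A' B'.
Proof.
by move=> AA BB [I [F FA]]; exists I, F => x y Bx By e; apply/AA/FA => //; apply: BB.
Qed.

Lemma fin_index_inter A A' B : fin_index A B -> fin_index A' B ->
  fin_index (A `&` A') B.
Proof.
move=> [I [F FA]] [J [E EA]]; exists (I * J)%type, (fun x => (F x, E x)) => x y Bx By.
by case=> e e'; split; [apply: FA|apply: EA].
Qed.

Lemma fin_index_restrict A B K : is_subgroup K -> K `<=` B -> fin_index A B ->
  fin_index (A `&` K) K.
Proof.
move=> gK KB [I [F FA]]; exists I, F => x y Kx Ky e; split.
  by apply: FA => //; apply: KB.
by apply: subgroupM => //; apply: subgroupV.
Qed.

Lemma fin_index_trans A B K : is_subgroup A -> is_subgroup B ->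
  fin_index A B -> fin_index B K -> fin_index A K.
Proof.
move=> gA gB /fin_index_reps[s [sB sP]] /fin_index_reps[r [rK rP]].
apply: (@reps_fin_index _ _ [seq y * x | y <- r, x <- s]) => // k Kk.
have [y yr By] := rP k Kk; have [x xs Ax] := sP _ By.
exists (y * x); first by apply: allpairs_f.
by move: Ax; group_word.
Qed.

Lemma fin_index_refl A : is_subgroup A -> fin_index A A.
Proof.
move=> gA; exists unit, (fun=> tt) => x y Ax Ay _.
by apply: subgroupM => //; apply: subgroupV.
Qed.

(** Two of the powers 1, x, ..., x^n lie in the same coset once n is the number
of colours. *)
Lemma fin_index_power A B x : is_subgroup B -> fin_index A B -> B x ->
  exists2 k, 0 < k & A (x ^+ k).
Proof.
move=> gB [I [F FA]] Bx; pose f (i : 'I_#|I|.+1) := F (x ^+ i).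
have : ~~ injectiveb f.
  by apply/negP => /injectiveP/leq_card; rewrite card_ord ltnn.
move/injectivePn => [i [j nij e]].
wlog lij : i j nij e / i < j.
  move=> H; case: (ltngtP i j) => [/H|/(H j i)|/val_inj ij].
  - by apply.
  - by apply; rewrite // eq_sym.
  - by rewrite ij eqxx in nij.
exists (j - i)%N; first by rewrite subn_gt0.
have := FA _ _ (subgroupX i gB Bx) (subgroupX j gB Bx) e.
by rewrite -{1}(subnKC (ltnW lij)) expgnDr mulKg.
Qed.

Definition core U K := [set g | K g /\ forall x, K x -> U (x^-1 * g * x)].

Lemma core_subgroup U K : is_subgroup U -> is_subgroup K -> is_subgroup (core U K).
Proof.
move=> gU gK; split.
- by split=> [|x Kx]; [apply: subgroup1|group_word; apply: subgroup1].
- move=> g h [Kg Ug] [Kh Uh]; split; first exact: subgroupM.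
  move=> x Kx; have -> : x^-1 * (g * h) * x = (x^-1 * g * x) * (x^-1 * h * x).
    by group_word.
  by apply: subgroupM; auto.
- move=> g [Kg Ug]; split; first exact: subgroupV.
  move=> x Kx; have -> : x^-1 * g^-1 * x = (x^-1 * g * x)^-1 by group_word.
  by apply: subgroupV; auto.
Qed.

Lemma core_sub U K : is_subgroup K -> core U K `<=` U.
Proof. by move=> gK g [Kg /(_ 1 (subgroup1 gK))]; group_word. Qed.

Lemma core_normal U K : is_subgroup K -> normalized (core U K) K.
Proof.
move=> gK x g Kx [Kg Ug]; split.
  by apply: subgroupM; [|apply: subgroupM|apply: subgroupV].
move=> y Ky; have -> : y^-1 * (x * g * x^-1) * y = (x^-1 * y)^-1 * g * (x^-1 * y).
  by group_word.
by apply: Ug; apply: subgroupM => //; apply: subgroupV.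
Qed.

(** An element g is in the core iff it fixes each of the finitely many cosets
t U, so the colours of the products g t determine its coset. *)
Lemma core_fin_index U K : is_subgroup U -> is_subgroup K -> fin_index U K ->
  fin_index (core U K) K.
Proof.
move=> gU gK fU; have [s [sK sP]] := fin_index_reps fU; have [I [F FU]] := fU.
exists {ffun 'I_(size s) -> I}, (fun g => [ffun i : 'I_(size s) => F (g * nth 1 s i)]).
move=> g h Kg Kh e; split; first by apply: subgroupM => //; apply: subgroupV.
move=> x Kx; have [t ts Ut] := sP x Kx.
have Kt := sK t ts; have it : index t s < size s by rewrite index_mem.
have /= := congr1 (fun f : {ffun _ -> _} => f (Ordinal it)) e.
rewrite !ffunE /= nth_index // => {}e.
have {}e := FU _ _ (subgroupM gK Kg Kt) (subgroupM gK Kh Kt) e.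
have -> : x^-1 * (g^-1 * h) * x = (t^-1 * x)^-1 * ((g * t)^-1 * (h * t)) * (t^-1 * x).
  by group_word.
by apply: subgroupM => //; apply: subgroupM => //; apply: subgroupV.
Qed.

(** Schreier's lemma.  Let t be a finite set of representatives containing 1, and
Y the set of the elements y^-1 a x of U with x and y in t and with a equal to 1, a
generator or the inverse of a generator.  The union of the cosets y <Y>, for y in
t, is stable under left multiplication by the generators and their inverses, so it
is K.  As Y contains the intersection of t and U, this gives U = <Y>. *)
Lemma fin_index_finitely_generated U K : finitely_generated K ->
  is_subgroup U -> U `<=` K -> fin_index U K -> finitely_generated U.
Proof.
move=> /finitely_generated_seq[s0 eK] gU UK fU.
have gK : is_subgroup K by rewrite eK; apply: generated_subgroup.
pose s := s0 ++ [seq x^-1 | x <- s0].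
have sK x : x \in s -> K x.
  rewrite mem_cat => /orP[xs|/mapP[y ys ->]]; last apply: subgroupV => //;
    by rewrite eK; apply: mem_generated.
have [t0 [t0K t0P]] := fin_index_reps fU.
pose t := 1 :: t0.
have tK x : x \in t -> K x.
  by rewrite inE => /orP[/eqP-> |/t0K //]; apply: subgroup1.
have tP x : K x -> exists2 y, y \in t & U (y^-1 * x).
  by move/t0P=> [y yt Uy]; exists y; rewrite // inE yt orbT.
pose l := [seq y^-1 * z | y <- t, z <- [seq a * x | a <- 1 :: s, x <- t]].
pose Y := [set z | z \in l /\ U z].
have YU : Y `<=` U by move=> z [].
have mY y a x : y \in t -> a \in 1 :: s -> x \in t -> U (y^-1 * (a * x)) ->
    generated Y (y^-1 * (a * x)).
  move=> yt ast xt Uz; apply: mem_generated; split=> //.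
  apply: (allpairs_f (fun y z => y^-1 * z)) => //; exact: (allpairs_f (fun a x => a * x)).
have gY := generated_subgroup Y.
exists Y; first by apply: (sub_finite_set _ (finite_seq l)) => z [].
apply/seteqP; split; last first.
  exact: generated_sub.
pose W := [set k | exists2 y, y \in t & generated Y (y^-1 * k)].
have W1 : W 1 by exists 1; rewrite ?inE ?eqxx //; group_word; apply: (subgroup1 gY).
have Ws a k : a \in s -> W k -> W (a * k).
  move=> as_ [y yt Yy].
  have [z zt Uz] := tP (a * y) (subgroupM gK (sK _ as_) (tK _ yt)).
  exists z; first by [].
  have -> : z^-1 * (a * k) = (z^-1 * (a * y)) * (y^-1 * k) by group_word.
  by apply: (subgroupM gY) Yy; apply: mY => //; rewrite inE as_ orbT.
have WK k : K k -> W k.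
  rewrite eK => Kk; suff : forall h, W h <-> W (k * h).
    by move/(_ 1) => [+ _]; rewrite mulg1; apply.
  apply: (Kk [set k | forall h, W h <-> W (k * h)]); split;
    first split=> [|x y xP yP h|x xP h].
  - by move=> h; rewrite mul1g.
  - by rewrite -mulgA -xP -yP.
  - by rewrite (xP (x^-1 * h)) mulVKg.
  - move=> a /= as0 h; split.
      by apply: Ws; rewrite mem_cat as0.
    move=> Wa; rewrite -(mulKg a h); apply: Ws Wa.
    by rewrite mem_cat map_f ?orbT.
move=> u Uu; have [y yt Yy] := WK u (UK _ Uu).
have Uy : U y.
  have -> : y = u * (y^-1 * u)^-1 by group_word.
  by apply: subgroupM => //; apply: subgroupV => //; apply: generated_sub Yy.
have -> : u = 1^-1 * (1 * y) * (y^-1 * u) by group_word.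
by apply: (subgroupM gY) Yy; apply: mY; rewrite ?inE ?eqxx //; group_word.
Qed.

(** * Derived subgroups and torsion *)

Definition derived K : set gT :=
  generated [set z | exists x y, [/\ K x, K y & z = x * y * x^-1 * y^-1]].

Lemma derived_subgroup K : is_subgroup (derived K).
Proof. exact: generated_subgroup. Qed.

Lemma derived_sub K : is_subgroup K -> derived K `<=` K.
Proof.
move=> gK; apply: generated_sub => // z [x [y [Kx Ky ->]]].
by repeat apply: subgroupM => //; apply: subgroupV.
Qed.

Lemma mem_derived K x y : K x -> K y -> derived K (x * y * x^-1 * y^-1).
Proof. by move=> Kx Ky; apply: mem_generated; exists x, y. Qed.

Lemma derived_normal K : is_subgroup K -> normalized (derived K) K.
Proof.
move=> gK x y Kx Dy; have -> : x * y * x^-1 = x * y * x^-1 * y^-1 * y by group_word.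
apply: (subgroupM (generated_subgroup _) _ Dy).
by apply: mem_derived => //; apply: derived_sub Dy.
Qed.

Lemma normalized_derived K L : is_subgroup L -> derived K `<=` L -> L `<=` K ->
   normalized L K.
Proof.
move=> gL DL LK x y Kx Ly; have -> : x * y * x^-1 = x * y * x^-1 * y^-1 * y by group_word.
by apply: subgroupM => //; apply: DL; apply: mem_derived => //; apply: LK.
Qed.

Lemma commutator_subgroup N K b : is_subgroup N -> is_subgroup K -> normalized N K ->
  is_subgroup [set a | K a /\ N (a * b * a^-1 * b^-1)].
Proof.
move=> gN gK nNK; split=> [|a c [Ka Na] [Kc Nc]|a [Ka Na]].
- by split; [apply: subgroup1|group_word; apply: subgroup1].
- split; first exact: subgroupM.
  have -> : a * c * b * (a * c)^-1 * b^-1 =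
    (a * (c * b * c^-1 * b^-1) * a^-1) * (a * b * a^-1 * b^-1) by group_word.
  by apply: subgroupM => //; apply: nNK.
- split; first exact: subgroupV.
  have -> : a^-1 * b * a^-1^-1 * b^-1 = a^-1 * (a * b * a^-1 * b^-1)^-1 * a.
    by group_word.
  by apply: (conjVx gK nNK Ka); apply: subgroupV.
Qed.

(** Commutator identities reduce commutators of products to conjugates of
commutators of generators, in each variable separately. *)
Lemma derived_generated_sub S N : is_subgroup N -> normalized N (generated S) ->
  (forall a b, S a -> S b -> N (a * b * a^-1 * b^-1)) -> derived (generated S) `<=` N.
Proof.
move=> gN nN SN; have gK := generated_subgroup S.
have Ncomm a b : N (a * b * a^-1 * b^-1) -> N (b * a * b^-1 * a^-1).
  have -> : b * a * b^-1 * a^-1 = (a * b * a^-1 * b^-1)^-1 by group_word.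
  exact: subgroupV.
apply: generated_sub => // _ [a [b [Ka Kb ->]]].
have gen c : (forall s, S s -> N (s * c * s^-1 * c^-1)) ->
    forall k, generated S k -> N (k * c * k^-1 * c^-1).
  move=> Sc k Kk; have [//] : [set a | generated S a /\ N (a * c * a^-1 * c^-1)] k.
  apply: (Kk [set a | generated S a /\ N (a * c * a^-1 * c^-1)]); split.
    exact: commutator_subgroup.
  by move=> s Ss; split; [apply: mem_generated|apply: Sc].
apply: (gen b _ a Ka) => s Ss; apply: Ncomm.
by apply: (gen s _ b Kb) => t St; apply: SN.
Qed.

Definition torsion K := forall x, K x -> exists2 n, 0 < n & x ^+ n = 1.

Lemma torsion_sub K L : K `<=` L -> torsion L -> torsion K.
Proof. by move=> KL tL x /KL/tL. Qed.

Lemma powers_subgroup (a : gT) n : 0 < n -> a ^+ n = 1 ->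
  is_subgroup [set x : gT | exists i, x = a ^+ i].
Proof.
move=> n0 an; split; first by exists 0%N.
  by move=> _ _ [i ->] [j ->]; exists (i + j)%N; rewrite expgnDr.
move=> _ [i ->]; exists (i * n.-1)%N; apply: mulg1_eq.
by rewrite -expgnDr -mulnS prednK // mulnC expgnA an expg1n.
Qed.

(** The abelianisation is finite: adjoining to B, which contains the
commutators, one more generator a of order n multiplies the index by at most n. *)
Lemma torsion_derived_fin_index K : finitely_generated K -> torsion K ->
  fin_index (derived K) K.
Proof.
move=> /finitely_generated_seq[s eK] tK.
have gK : is_subgroup K by rewrite eK; apply: generated_subgroup.
have sK t : t \in s -> K t by rewrite eK => ts; apply: mem_generated.
suff main B : is_subgroup B -> derived K `<=` B -> B `<=` K ->
    fin_index B (generated (B `|` [set` s])).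
  have := main _ (generated_subgroup _) (fun _ => id) (derived_sub gK).
  apply: fin_index_sub => //; rewrite {1}eK.
  apply: generated_sub; first exact: generated_subgroup.
  by move=> t ts; apply: mem_generated; right.
elim: s {eK} sK B => [|a s IH] sK B gB DB BK.
  apply: (fin_index_sub _ _ (fin_index_refl gB)) => //.
  by apply: generated_sub => // x [].
have Ka : K a by apply: sK; rewrite mem_head.
have [n n0 an] := tK a Ka.
have gP := powers_subgroup n0 an; set P := [set x | _] in gP.
have PK : P `<=` K by move=> _ [i ->]; apply: subgroupX.
have nB : normalized B K by apply: normalized_derived.
have gB1 : is_subgroup (prod_set P B).
  by apply: prod_set_subgroup => // x y /PK; apply: nB.
apply: (@fin_index_trans _ (prod_set P B)) => //.
  apply: (@reps_fin_index _ _ [seq a ^+ i | i <- iota 0 n]) => //.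
  move=> b [_ [i ->] Bb]; exists (a ^+ (i %% n)).
    by apply: map_f; rewrite mem_iota /= add0n ltn_mod.
  by move: Bb; rewrite {1}(divn_eq i n) expgnDr mulnC expgnA an expg1n mul1g.
apply: (@fin_index_sub (prod_set P B) _ (generated (prod_set P B `|` [set` s]))) => //;
  last apply: IH => //.
- apply: generated_sub; first exact: generated_subgroup.
  move=> x [Bx|].
    by apply: mem_generated; left; apply: prod_set_subr.
  rewrite /= inE => /orP[/eqP->|xs]; apply: mem_generated; last by right.
  by left; apply: prod_set_subl => //; exists 1%N.
- by move=> t ts; apply: sK; rewrite inE ts orbT.
- by move=> x /DB; apply: prod_set_subr.
- exact: prod_set_sub.
Qed.

(** * The profinite topology *)

(** The cosets of the finite-index subgroups of G are a basis of the profinite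
topology of G. *)
Definition prof_closed G N := forall g, G g -> ~ N g ->
  exists U, [/\ subgroup_of U G, fin_index U G & forall u, U u -> ~ N (g * u)].

Lemma prof_closed_lcoset G N x : is_subgroup G -> G x -> prof_closed G N ->
  prof_closed G [set g | N (x^-1 * g)].
Proof.
move=> gG Gx cN g Gg nNg.
have [|U [sU fU NU]] := cN _ _ nNg; first by apply: subgroupM => //; apply: subgroupV.
by exists U; split=> // u Uu /=; rewrite mulgA; apply: NU.
Qed.

Lemma prof_closed_union G (I : eqType) (s : seq I) (N : I -> set gT) :
  is_subgroup G -> (forall i, i \in s -> prof_closed G (N i)) ->
  prof_closed G [set g | exists2 i, i \in s & N i g].
Proof.
move=> gG; elim: s => [|i s IH] cN g Gg nNg.
  by exists G; split; [split=> // x|exact: fin_index_refl|move=> u _ []].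
have [|U [[gU UG] fU NU]] := cN i (mem_head _ _) g Gg.
  by move=> Nig; apply: nNg; exists i; rewrite ?mem_head.
have [j js||V [[gV VG] fV NV]] := IH _ g Gg.
- by apply: cN; rewrite inE js orbT.
- by move=> [j js Njg]; apply: nNg; exists j => //; rewrite inE js orbT.
exists (U `&` V); split; first by split; [exact: subgroupI|move=> x [/UG]].
  exact: fin_index_inter.
move=> u [Uu Vu] [j]; rewrite inE => /orP[/eqP->|js] Nj; first exact: NU Nj.
by apply: (NV u Vu); exists j.
Qed.

Lemma prof_closedI G M N : is_subgroup G -> prof_closed G M -> prof_closed G N ->
  prof_closed G (M `&` N).
Proof.
move=> gG cM cN g Gg /not_andP[/(cM _ Gg)|/(cN _ Gg)] [U [sU fU UM]];
  by exists U; split=> // u /UM + [].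
Qed.

Lemma prof_closed_fin_index G A B : is_subgroup G -> is_subgroup B ->
  A `<=` B -> B `<=` G ->
  fin_index A B -> prof_closed G A -> prof_closed G B.
Proof.
move=> gG gB AB BG /fin_index_reps[s [sB sP]] cA.
have -> : B = [set g | exists2 t, t \in s & A (t^-1 * g)].
  apply/seteqP; split=> [x /sP //|x [t /sB Bt /AB Btx]].
  by rewrite -(mulVKg t x); apply: subgroupM.
by apply: prof_closed_union => // t /sB/BG Gt; apply: prof_closed_lcoset.
Qed.

Lemma fin_index_closed G U : is_subgroup G -> subgroup_of U G -> fin_index U G ->
  prof_closed G U.
Proof.
move=> gG [gU UG] fU g Gg nUg; exists U; split=> // u Uu Ugu; apply: nUg.
by rewrite -(mulgK u g); apply: subgroupM => //; apply: subgroupV.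
Qed.

Lemma prof_closed_sep G K y : is_subgroup G -> is_subgroup K -> K `<=` G ->
  prof_closed G K -> G y -> ~ K y ->
  exists C, [/\ subgroup_of C G, fin_index C G, normalized C G & ~ prod_set K C y].
Proof.
move=> gG gK KG cK Gy nKy; have [U [[gU UG] fU UK]] := cK y Gy nKy.
exists (core U G); split.
- by split; [exact: core_subgroup|move=> x []].
- exact: core_fin_index.
- exact: core_normal.
- move=> [k Kk /(core_sub gG) Uky]; apply: (UK (k^-1 * y)^-1).
    exact: subgroupV.
  by group_word.
Qed.

(** * Finite quotients and the Frattini subgroup *)

(** The action of G by left translation on the finite set of cosets of C;
inverses turn it into a morphism for the composition order of permutations. *)
Lemma finite_quotient G C : is_subgroup G -> subgroup_of C G -> fin_index C G ->
  normalized C G -> exists (qT : finGroupType) (f : gT -> qT),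
    (forall x y, G x -> G y -> f (x * y) = f x * f y) /\
    (forall x, G x -> f x = 1 <-> C x).
Proof.
move=> gG [gC CG] /(finite_indexP _ gC)/finite_seqP[s sP] nCG.
have msP x : G x -> left_coset C x \in s.
  move=> Gx; have : [set left_coset C x | x in G] (left_coset C x) by exists x.
  by rewrite sP.
have smP A : A \in s -> exists2 x, G x & A = left_coset C x.
  move=> As; have : [set` s] A by [].
  by rewrite -sP => -[x Gx <-]; exists x.
pose act g (A : set gT) : set gT := [set g^-1 * a | a in A].
have actE g x : act g (left_coset C x) = left_coset C (g^-1 * x).
  apply/seteqP; split=> [_ [_ [c Cc <-] <-]|_ [c Cc <-]].
    by exists c; rewrite ?mulgA.
  by exists (x * c); [exists c|rewrite mulgA].
have acts g A : G g -> A \in s -> act g A \in s.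
  move=> Gg /smP[x Gx ->]; rewrite actE; apply: msP.
  by apply: subgroupM => //; apply: subgroupV.
pose T := seq_sub s.
(* the default value 1 is only taken for g outside G *)
pose f g : {perm T} :=
  odflt 1 [pick p : {perm T} | [forall A : T, ssval (p A) == act g (ssval A)]].
have fE g (A : T) : G g -> ssval (f g A) = act g (ssval A).
  move=> Gg; rewrite /f; case: pickP => [p /forallP/(_ A)/eqP //|].
  pose h (A : T) : T := SeqSub (acts _ _ Gg (ssvalP A)).
  have hI : injective h.
    move=> [A0 As] [B0 Bs] /(congr1 (@ssval _ _)) /=.
    have [x Gx eA] := smP _ As; have [y Gy eB] := smP _ Bs.
    move=> e; apply: val_inj => /=; move/(congr1 (act g^-1)): e.
    by rewrite eA eB !actE !invgK !mulVKg.
  by move/(_ (perm hI))/negP; case; apply/forallP => B; rewrite permE.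
exists {perm T}, f; split=> [x y Gx Gy|x Gx].
  apply/permP => A; apply: val_inj; rewrite permM /=.
  have [z Gz eA] := smP _ (ssvalP A).
  by rewrite !fE ?eA ?actE //; [group_word|exact: subgroupM].
split=> [e|Cx].
  have G1 := subgroup1 gG.
  have /= := congr1 (fun p : {perm T} => ssval (p (SeqSub (msP _ G1)))) e.
  rewrite fE // perm1 /= actE => {}e.
  have : left_coset C (x^-1 * 1) x^-1.
    by exists 1; [apply: subgroup1|group_word].
  rewrite e => -[c Cc]; rewrite mul1g => e'.
  by rewrite -[x]invgK -e'; apply: subgroupV.
apply/permP => A; apply: val_inj; rewrite perm1 /= fE //.
have [y Gy ->] := smP _ (ssvalP A); rewrite actE; apply: left_coset_eq => //.
have -> : (x^-1 * y)^-1 * y = y^-1 * x * y by group_word.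
exact: conjVx Gy Cx.
Qed.

(** Otherwise H would lie in a proper normal subgroup K of G, as every subgroup
of a nilpotent group is subnormal, and the nontrivial nilpotent group G / K would
be equal to its derived subgroup. *)
Lemma nilpotent_mul_der1 (qT : finGroupType) (G H : {group qT}) :
  nilpotent G -> H \subset G -> G \subset H * G^`(1) -> G \subset H.
Proof.
move=> nG sHG sGH; have /subnormalEr[-> //|[K [sHK nKG pKG]]] := nilpotent_subnormal nG sHG.
have : G / K != 1 by rewrite -subG1 quotient_sub1 ?normal_norm // proper_subn.
move/(sol_der1_proper (nilpotent_sol (quotient_nil K nG)) (subxx _)).
rewrite properE => /andP[_ /negP[]].
rewrite -quotient_der ?normal_norm //.
have nHK : H \subset 'N(K).
  exact: (fintype.subset_trans sHG (normal_norm nKG)).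
have := quotientS K sGH; rewrite quotientMl //.
have HK1 : H / K = 1 by apply/trivgP; rewrite quotient_sub1 ?(subnormal_sub sHK).
by rewrite HK1 mul1g.
Qed.

(** By the Frattini argument, the normaliser of a Sylow subgroup of 'Phi(G)
supplements 'Phi(G), hence is G.  So all Sylow subgroups of 'Phi(G) are normal. *)
Lemma nilpotent_Frattini (qT : finGroupType) (G : {group qT}) : nilpotent 'Phi(G).
Proof.
apply: (nilpotentS _ (Fitting_nil 'Phi(G))).
suff : <<\bigcup_(P : {group qT} | Sylow 'Phi(G) P) P>> \subset 'F('Phi(G)).
  by rewrite (Sylow_gen 'Phi(G)%G).
rewrite gen_subG.
apply/bigcupsP => P /SylowP[p _ sylP].
have NP : 'N_G(P) = G.
  have := Frattini_arg (Phi_normal G) sylP; rewrite -norm_joinEr; last first.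
    apply: (fintype.subset_trans (subsetIl _ _)).
    exact: (normal_norm (Phi_normal G)).
  by move/Phi_nongen; rewrite genGid.
apply: Fitting_max (pgroup_nil (pHall_pgroup sylP)).
rewrite /normal (pHall_sub sylP) /=.
by apply: (fintype.subset_trans (Phi_sub G)); rewrite -{1}NP; apply: subsetIr.
Qed.

(** The maximal subgroups of the finite quotient G / C pull back to maximal
subgroups of finite index, so the image of K is contained in the Frattini subgroup
of G / C and is nilpotent. *)
Lemma frattini_nilpotent_quotient G C K P :
  is_subgroup G -> subgroup_of C G -> fin_index C G -> normalized C G ->
  is_subgroup K -> K `<=` frattini_fi G -> is_subgroup P -> P `<=` K ->
  K `<=` prod_set P (derived K) -> K `<=` prod_set P C.
Proof.
move=> gG [gC CG] fC nCG gK KPhi gP PK KPD.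
have [qT [f [fM f1]]] := finite_quotient gG (conj gC CG) fC nCG.
have KG : K `<=` G by move=> x /KPhi[].
have PG : P `<=` G by move=> x /PK/KG.
have f_1 := partial_hom1 gG fM.
have fV x := partial_homV (x := x) gG fM.
have feq x y : G x -> G y -> f x = f y -> C (x^-1 * y).
  move=> Gx Gy e; apply/f1; first by apply: subgroupM => //; apply: subgroupV.
  by rewrite fM ?fV ?e ?mulVg //; apply: subgroupV.
pose im (A : set gT) : {set qT} := finset (fun q => `[< exists2 x, A x & f x = q >]).
have imP A q : reflect (exists2 x, A x & f x = q) (q \in im A).
  by rewrite inE; apply: asboolP.
have im_group A : is_subgroup A -> A `<=` G -> group_set (im A).
  move=> gA AG; apply/group_setP; split.
    by apply/imP; exists 1 => //; apply: subgroup1.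
  move=> _ _ /imP[x Ax <-] /imP[y Ay <-]; apply/imP; exists (x * y).
    exact: subgroupM.
  by rewrite fM //; apply: AG.
pose imG := Group (im_group G gG (fun _ => id)).
pose imK := Group (im_group K gK KG).
pose imP' := Group (im_group P gP PG).
have KPhi' : imK \subset 'Phi(imG).
  apply/bigcapsP => M /predU1P[eM|/maxgroupP[pMG maxM]].
    apply/fintype.subsetP => _ /imP[x Kx <-]; rewrite eM.
    by apply/imP; exists x => //; apply/KG.
  have [sMG [q qG nqM]] := properP pMG.
  (* the preimage N of M is a maximal subgroup of finite index *)
  pose N := [set x | G x /\ f x \in M].
  have gN : is_subgroup N.
    split=> [|x y [Gx Mx] [Gy My]|x [Gx Mx]].
    - by split; [apply: subgroup1|rewrite f_1 group1].
    - by split; [apply: subgroupM|rewrite fM // groupM].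
    - by split; [apply: subgroupV|rewrite fV // groupV].
  have NG : N `<=` G by move=> x [].
  have CN : C `<=` N.
    by move=> x Cx; split; [apply: CG|rewrite (f1 x (CG _ Cx)).2 // group1].
  have maxN : maximal_subgroup N G.
    split=> [//|e|L gL NL LG].
      case/imP: qG => x; rewrite -e => -[_ xM] eq.
      by rewrite -eq xM in nqM.
    pose imL := Group (im_group L gL LG).
    have sML : M \subset imL.
      apply/fintype.subsetP => r rM; have /imP[x Gx xr] := fintype.subsetP sMG r rM.
      by apply/imP; exists x => //; apply: NL; split=> //; rewrite xr.
    have sLG : imL \subset imG.
      by apply/fintype.subsetP => _ /imP[x Lx <-]; apply/imP; exists x => //; apply/LG.
    have LE x : G x -> f x \in imL -> L x.
      move=> Gx /imP[y Ly fxy]; rewrite -(mulVKg y x); apply: subgroupM => //.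
      by apply/NL/CN/feq => //; apply/LG.
    have [pL|] := boolP (imL \proper imG).
      left; apply/seteqP; split=> // x Lx; split; first exact/LG.
      by rewrite -(maxM imL pL sML); apply/imP; exists x.
    rewrite properE sLG /= negbK => sGL; right; apply/seteqP; split=> // x Gx.
    by apply: LE => //; apply: (fintype.subsetP sGL); apply/imP; exists x.
  apply/fintype.subsetP => _ /imP[x Kx <-]; have [_] := KPhi x Kx.
  move=> /(_ N); case=> //; split=> //; apply/finite_indexP => //.
  exact: fin_index_sub fC.
have nK : nilpotent imK by apply: nilpotentS KPhi' (nilpotent_Frattini _).
have derK x : derived K x -> f x \in imK^`(1).
  move=> Dx; suff [_] : [set x | G x /\ f x \in imK^`(1)] x by [].
  apply: (generated_sub _ _ Dx).
    split=> [|y z [Gy My] [Gz Mz]|y [Gy My]].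
    - by split; [apply: subgroup1|rewrite f_1 group1].
    - by split; [apply: subgroupM|rewrite fM // groupM].
    - by split; [apply: subgroupV|rewrite fV // groupV].
  move=> _ [y [z [Ky Kz ->]]].
  have [[Gy Gz] [GVy GVz]] : (G y /\ G z) /\ (G y^-1 /\ G z^-1).
    by repeat split; try apply: subgroupV => //; apply/KG.
  have Gyz := subgroupM gG Gy Gz; have Gyzy := subgroupM gG Gyz GVy.
  split; first exact: subgroupM.
  rewrite !fM // !fV //.
  have -> : f y * f z * (f y)^-1 * (f z)^-1 = [~ (f y)^-1, (f z)^-1].
    by rewrite commgEl conjgE; group_word.
  by apply: mem_commg; rewrite groupV; apply/imP; [exists y|exists z].
have sKP : imK \subset imP'.
  apply: (nilpotent_mul_der1 nK).
    by apply/fintype.subsetP => _ /imP[x Px <-]; apply/imP; exists x => //; apply: PK.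
  apply/fintype.subsetP => _ /imP[x Kx <-]; have [p Pp Dp] := KPD x Kx.
  apply/mulsgP; exists (f p) (f (p^-1 * x)).
  - by apply/imP; exists p.
  - exact: derK.
  - have [Gp Gx] := (PG _ Pp, KG _ Kx).
    rewrite -fM ?mulVKg //; apply: subgroupM => //; exact: subgroupV.
move=> x Kx; have /imP[p Pp fp] : f x \in imP'.
  by apply: (fintype.subsetP sKP); apply/imP; exists x.
by exists p => //; apply: feq => //; [apply/PG|apply/KG].
Qed.

Lemma maximal_subgroup_conj G M x : is_subgroup G -> G x -> maximal_subgroup M G ->
  maximal_subgroup [set g | M (x * g * x^-1)] G.
Proof.
move=> gG Gx [[gM MG] MneG maxM].
have conj_group (y : gT) K : is_subgroup K -> is_subgroup [set g | K (y * g * y^-1)].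
  move=> gK; split=> [|a b Ka Kb|a Ka] /=; first by group_word; apply: subgroup1.
    have -> : y * (a * b) * y^-1 = (y * a * y^-1) * (y * b * y^-1) by group_word.
    exact: subgroupM.
  have -> : y * a^-1 * y^-1 = (y * a * y^-1)^-1 by group_word.
  exact: subgroupV.
have conjG y g : G y -> G g -> G (y * g * y^-1).
  by move=> Gy Gg; apply: subgroupM => //; [apply: subgroupM|apply: subgroupV].
have conjK (y g : gT) : y * (y^-1 * g * y^-1^-1) * y^-1 = g by group_word.
have conjVK (y g : gT) : y^-1 * (y * g * y^-1) * y^-1^-1 = g by group_word.
have GxV := subgroupV gG Gx.
split.
- split; first exact: conj_group.
  by move=> g /MG/(conjG _ _ GxV); rewrite conjVK.
- move=> e; apply: MneG; apply/seteqP; split=> // g Gg.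
  have : [set g | M (x * g * x^-1)] (x^-1 * g * x^-1^-1) by rewrite e; apply: conjG.
  by rewrite /= conjK.
- move=> K gK MK KG.
  have [||| e|e] := maxM [set g | K (x^-1 * g * x^-1^-1)].
  + exact: conj_group.
  + by move=> g Mg; apply: MK; rewrite /= conjK.
  + by move=> g /KG/(conjG _ _ Gx); rewrite conjK.
  + left; apply/seteqP; split=> // g Kg /=; rewrite -e /=.
    by rewrite conjVK.
  + right; apply/seteqP; split=> // g Gg; have := conjG _ _ Gx Gg.
    by rewrite -e /= conjVK.
Qed.

Lemma frattini_fi_subgroup (G : set gT) : is_subgroup G -> is_subgroup (frattini_fi G).
Proof.
move=> gG; split=> [|x y [Gx Mx] [Gy My]|x [Gx Mx]].
- by split=> [|M [[[gM _] _ _] _]]; apply: subgroup1.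
- split; first exact: subgroupM.
  move=> M mM; have [[[gM _] _ _] _] := mM.
  by apply: subgroupM => //; [apply: Mx|apply: My].
- split; first exact: subgroupV.
  move=> M mM; have [[[gM _] _ _] _] := mM.
  by apply: subgroupV => //; apply: Mx.
Qed.

Lemma frattini_fi_normal G : is_subgroup G -> normalized (frattini_fi G) G.
Proof.
move=> gG x y Gx [Gy My]; split.
  by apply: subgroupM => //; [apply: subgroupM|apply: subgroupV].
move=> M [maxM fM]; have [[gM MG] _ _] := maxM.
have maxMx := maximal_subgroup_conj gG Gx maxM.
have [[gMx _] _ _] := maxMx.
apply: (My [set g | M (x * g * x^-1)]); split=> //.
apply/(finite_indexP _ gMx); have [I [F FM]] := (finite_indexP _ gM).1 fM.
have Gconj g : G g -> G (x * g * x^-1).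
  by move=> Gg; apply: subgroupM => //; [apply: subgroupM|apply: subgroupV].
exists I, (fun g => F (x * g * x^-1)) => a b Ga Gb e.
have := FM _ _ (Gconj a Ga) (Gconj b Gb) e.
by rewrite /=; group_word.
Qed.

(** * Maximal subgroups of finite-index overgroups *)

(** If M has infinite index then the intersection of M and H0 is a proper
subgroup of H0, hence is contained in some proper L of finite index.  The normal
core C of L satisfies M C <> H, since M C = H would give H0 = (M `&` H0) C, which
is contained in L.  By maximality C is contained in M. *)
Lemma fin_index_overgroup_maximal H0 M :
  is_subgroup H0 -> fin_index H0 setT ->
  (forall P, subgroup_of P H0 -> ~ H0 `<=` P -> exists L,
     [/\ subgroup_of L H0, P `<=` L, fin_index L H0 & ~ H0 `<=` L]) ->
  maximal_subgroup M setT -> fin_index M setT.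
Proof.
move=> gH0 fH0 H0P [[gM _] _ maxM].
have gsetT : is_subgroup [set: gT] by [].
case: (pselect (H0 `<=` H0 `&` M)) => [H0M|nH0M].
  by apply: fin_index_sub fH0 => // h /H0M[].
have [|L [[gL LH0] ML fL nL]] := H0P _ _ nH0M.
  by split; [apply: subgroupI|move=> h []].
have fLT := fin_index_trans gL gH0 fL fH0.
pose C := core L setT.
have gC : is_subgroup C by apply: core_subgroup.
have CL : C `<=` L by apply: core_sub.
have fC : fin_index C setT by apply: core_fin_index.
have gMC : is_subgroup (prod_set M C).
  by apply: prod_set_subgroup => //; move=> x y _; apply: (core_normal gsetT).
have [|||eM|eT] := maxM (prod_set M C) => //.
- exact: prod_set_subl.
- rewrite -eM; apply: fin_index_sub fC => //; exact: prod_set_subr.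
case: nL => h H0h; have [m Mm Cmh] : prod_set M C h by rewrite eT.
have Lmh := CL _ Cmh; rewrite -(mulVKg m h); apply: subgroupM => //.
apply: ML; split=> //.
have -> : m = h * (m^-1 * h)^-1 by group_word.
by apply: subgroupM => //; apply: subgroupV => //; apply: LH0.
Qed.

(** Only finitely many elements of P are needed to express the generators of K
modulo [K, K]; the subgroup L that they generate is finitely generated, which is
what makes it closed. *)
Lemma proper_subgroup_fin_index G K P : is_subgroup G -> torsion G ->
  (forall L, finitely_generated L -> subgroup_of L G -> prof_closed G L) ->
  subgroup_of K G -> K `<=` frattini_fi G -> finitely_generated K ->
  subgroup_of P K -> ~ K `<=` P ->
  exists L, [/\ is_subgroup L, P `<=` L, fin_index L K & ~ K `<=` L].
Proof.
move=> gG tG lerf [gK KG] KPhi fgK [gP PK] nKP.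
have gD := derived_subgroup K; have DK := derived_sub gK; have nDK := derived_normal gK.
have gPD Q : is_subgroup Q -> Q `<=` K -> is_subgroup (prod_set Q (derived K)).
  by move=> gQ QK; apply: prod_set_subgroup => //; apply: normalized_sub nDK.
exists (prod_set P (derived K)); split.
- exact: gPD.
- exact: prod_set_subl.
- apply: fin_index_sub (torsion_derived_fin_index fgK (torsion_sub KG tG)) => //.
  exact: prod_set_subr.
move=> KPD; have [s eK] := finitely_generated_seq fgK.
have sK t : t \in s -> K t by rewrite eK => ts; apply: mem_generated.
have /choice[p pP] t : exists q, t \in s -> P q /\ derived K (q^-1 * t).
  case: (pselect (t \in s)) => [/sK/KPD[q Pq Dq]|]; last by exists 1.
  by exists q.
pose L := generated [set` map p s].
have gL : is_subgroup L by apply: generated_subgroup.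
have LP : L `<=` P by apply: generated_sub => // _ /mapP[t ts ->]; case: (pP t ts).
have LK : L `<=` K by move=> x /LP/PK.
have LG : L `<=` G by move=> x /LK/KG.
have cL : prof_closed G L.
  apply: lerf; last by split.
  by exists [set` map p s]; first exact: finite_seq.
have KLD : K `<=` prod_set L (derived K).
  rewrite {1}eK; apply: generated_sub; first exact: gPD.
  move=> t ts; have [Pp Dp] := pP t ts; exists (p t) => //.
  by apply: mem_generated; apply: map_f.
apply: nKP => k Kk; apply: LP; apply: contrapT => nLk.
have [C [sC fC nC]] := prof_closed_sep gG gL LG cL (KG k Kk) nLk.
by apply; apply: (frattini_nilpotent_quotient gG sC fC nC gK KPhi gL LK KLD).
Qed.

End AbstractGroups.

Lemma fin_index_image (gT hT : groupType) (f : gT -> hT) (A B : set gT) :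
  is_subgroup B -> (forall x y : gT, B x -> B y -> f (x * y) = f x * f y) ->
  fin_index A B -> fin_index (f @` A) (f @` B).
Proof.
move=> gB fM [I [F FA]].
have fV x := partial_homV (x := x) gB fM.
pose r y := xget 1 [set x | B x /\ f x = y].
have rP y : (f @` B) y -> B (r y) /\ f (r y) = y.
  by move=> [x Bx fx]; rewrite /r; case: xgetP => [z -> //|/(_ x)]; case.
exists I, (fun y => F (r y)) => y z /rP[By fy] /rP[Bz fz] e.
exists ((r y)^-1 * r z); first exact: FA.
by rewrite fM ?fV ?fy ?fz //; apply: subgroupV.
Qed.

(** * Automorphisms of the regular rooted tree *)

Section TreeAutomorphisms.
Variable d : nat.
Implicit Types (g h a b : tree_aut d) (u v w : vertex d) (G H K N : set (tree_aut d)).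

Lemma tree_aut_inj g : injective g.
Proof. by case: (tree_autP g) => /bij_inj. Qed.

Lemma tree_autVK g v : g^-1 (g v) = v.
Proof. by rewrite -tree_aut_mulE mulVg. Qed.

Lemma tree_autKV g v : g (g^-1 v) = v.
Proof. by rewrite -tree_aut_mulE mulgV. Qed.

Lemma tree_aut_prefix g v w : prefix (g v) (g w) = prefix v w.
Proof.
have H f x y : prefix x y -> prefix ((f : tree_aut d) x) (f y).
  by move=> /prefixP[z ->]; rewrite tree_sectionP prefix_prefix.
by apply/idP/idP; [rewrite -{2}(tree_autVK g v) -{2}(tree_autVK g w)|]; apply: H.
Qed.

Lemma tree_aut_take g n v : g (take n v) = take n (g v).
Proof.
have := tree_sectionP (take n v) g (drop n v); rewrite cat_take_drop => ->.
case: (leqP n (size v)) => nv.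
  by rewrite take_size_cat // tree_aut_size size_takel.
have /ltnW nv' := nv; rewrite !(take_oversize nv') drop_oversize // take_oversize.
  by case: (tree_autP (tree_section v g)) => _ ->; rewrite cats0.
by rewrite size_cat !tree_aut_size addn0.
Qed.

Lemma tree_aut_fix_take g n v : g v = v -> g (take n v) = take n v.
Proof. by move=> e; rewrite tree_aut_take e. Qed.

Lemma tree_sectionM v g h : h v = v ->
  tree_section v (g * h) = tree_section v g * tree_section v h.
Proof.
move=> hv; apply/esym/tree_section_uniq => w.
by rewrite !tree_aut_mulE tree_sectionP hv tree_sectionP.
Qed.

Lemma tree_section1 v : tree_section v 1 = 1.
Proof. by apply/esym/tree_section_uniq. Qed.

Lemma tree_sectionV v g : g v = v -> tree_section v g^-1 = (tree_section v g)^-1.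
Proof.
move=> gv; apply/esym/mulg1_eq; rewrite -tree_sectionM ?mulgV ?tree_section1 //.
by rewrite -{1}gv tree_autVK.
Qed.

Lemma tree_autX_fix g n v : g v = v -> (g ^+ n) v = v.
Proof. by move=> gv; elim: n => // n IH; rewrite expgS tree_aut_mulE IH. Qed.

Lemma tree_sectionX v g n : g v = v -> tree_section v (g ^+ n) = tree_section v g ^+ n.
Proof.
move=> gv; elim: n => [|n IH]; first exact: tree_section1.
by rewrite !expgS tree_sectionM ?IH // tree_autX_fix.
Qed.

Lemma tree_aut_eq_level1 g h :
  (forall x : 'I_d, g [:: x] = h [:: x] /\ tree_section [:: x] g = tree_section [:: x] h) ->
  g = h.
Proof.
move=> e; apply: tree_aut_ext => -[|x w].
  by case: (tree_autP g) => _ -> _; case: (tree_autP h) => _ ->.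
by rewrite -cat1s !tree_sectionP; have [-> ->] := e x.
Qed.

Lemma tree_aut_fix_large k g : (forall v, k <= size v -> g v = v) ->
  (0 < d) -> g = 1.
Proof.
move=> gk d0; apply: tree_aut_ext => v; rewrite tree_aut_1E.
rewrite -(@take_size_cat _ (size v) v (nseq k (Ordinal d0))) //.
by apply: tree_aut_fix_take; apply: gk; rewrite size_cat size_nseq leq_addl.
Qed.

Lemma tree_aut_neq1 g : g <> 1 -> exists v, g v <> v.
Proof.
move=> g1; apply/not_existsP => H; apply: g1; apply: tree_aut_ext => v.
by apply: contrapT; apply: H.
Qed.

Lemma pstab_subgroup G V : is_subgroup G -> is_subgroup (pstab G V).
Proof.
move=> gG; split=> [|g h [Gg gV] [Gh hV]|g [Gg gV]].
- by split; [apply: subgroup1|].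
- by split; [apply: subgroupM|move=> v Vv; rewrite tree_aut_mulE hV ?gV].
- by split; [apply: subgroupV|move=> v Vv; rewrite -{1}(gV v Vv) tree_autVK].
Qed.

Lemma fin_index_pstab_level G n : is_subgroup G -> fin_index (pstab G (level n)) G.
Proof.
move=> gG; exists {ffun n.-tuple 'I_d -> option (n.-tuple 'I_d)},
  (fun g => [ffun t : n.-tuple _ => insub (g (t : vertex d))]) => g h Gg Gh e.
split; first by apply: subgroupM => //; apply: subgroupV.
move=> v /eqP vn; have := congr1 (fun f : {ffun _ -> _} => f (Tuple vn)) e.
rewrite !ffunE /=.
case: insubP => [a _ ea|]; last by rewrite tree_aut_size vn.
case: insubP => [b _ eb|]; last by rewrite tree_aut_size vn.
by case=> eab; rewrite -eb -eab ea tree_autVK.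
Qed.

Lemma fin_index_vertex_stab G v : is_subgroup G ->
  exists U, [/\ subgroup_of U G, fin_index U G & forall g, U g -> g v = v].
Proof.
move=> gG; exists (pstab G (level (size v))); split.
- by split; [exact: pstab_subgroup|move=> g []].
- exact: fin_index_pstab_level.
- by move=> u [_]; apply.
Qed.

Lemma pstab_closed G (F : set (vertex d)) : is_subgroup G -> prof_closed G (pstab G F).
Proof.
move=> gG g Gg; move/not_andP=> [//|/existsNP[v /not_implyP[Fv gv]]].
have [U [sU fU Uv]] := fin_index_vertex_stab v gG.
by exists U; split=> // u Uu [_ /(_ v Fv)]; rewrite tree_aut_mulE Uv.
Qed.

End TreeAutomorphisms.

(** * Rigid stabilisers *)

Section RigidStabilisers.
Variable d : nat.
Implicit Types (g h a b : tree_aut d) (u v w : vertex d) (G H K N : set (tree_aut d)).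

Lemma rist_fix G v a : rist G v a -> a v = v.
Proof.
move=> [Ga aV]; apply: contrapT => nav; apply: (nav); apply: (@tree_aut_inj _ a).
apply: aV; apply/negP => /prefixP[w e]; apply: nav.
have := congr1 size e; rewrite tree_aut_size size_cat => /eqP.
rewrite -{1}[size v]addn0 eqn_add2l eq_sym => /nilP w0.
by rewrite e w0 cats0.
Qed.

Lemma rist_subgroup G v : is_subgroup G -> is_subgroup (rist G v).
Proof.
move=> gG; split=> [|a b [Ga aV] [Gb bV]|a [Ga aV]].
- by split; [apply: subgroup1|].
- by split; [apply: subgroupM|move=> w vw; rewrite tree_aut_mulE bV ?aV].
- by split; [apply: subgroupV|move=> w vw; rewrite -{1}(aV w vw) tree_autVK].
Qed.

Lemma rist_conj G g v a : is_subgroup G -> G g -> rist G v a ->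
  rist G (g v) (g * a * g^-1).
Proof.
move=> gG Gg [Ga aV]; split.
  by apply: subgroupM => //; [apply: subgroupM|apply: subgroupV].
move=> w gvw; rewrite !tree_aut_mulE aV ?tree_autKV //.
by rewrite -(tree_aut_prefix g) tree_autKV.
Qed.

Lemma rist_commute G v w a b : size v = size w -> v <> w ->
  rist G v a -> rist G w b -> a * b = b * a.
Proof.
move=> svw nvw Ra Rb; have [[_ aV] [_ bW]] := (Ra, Rb).
have disj x : prefix v x -> ~~ prefix w x.
  rewrite !prefixE => /eqP ev; apply/negP => /eqP ew; apply: nvw.
  by rewrite -ev -ew svw.
apply: tree_aut_ext => x; rewrite !tree_aut_mulE.
case: (boolP (prefix v x)) => vx.
  have vax : prefix v (a x) by rewrite -(rist_fix Ra) tree_aut_prefix.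
  by rewrite (bW _ (disj _ vax)) (bW _ (disj _ vx)).
rewrite (aV x vx); case: (boolP (prefix w x)) => wx; last by rewrite bW // aV.
rewrite aV //; apply/negP => /disj/negP; apply.
by rewrite -(rist_fix Rb) tree_aut_prefix.
Qed.

(** With c = n b^-1 n^-1, supported below n v, the element b c = [b, n] lies
in N, and [a, b c] = [a, b] because c commutes with a. *)
Lemma rist_commutator_mem G (R N : set (tree_aut d)) n v a b :
  is_subgroup G -> G n ->
  is_subgroup N -> normalized N R -> is_subgroup R -> R `<=` rist G v ->
  N n -> n v <> v -> R a -> R b -> N (a * b * a^-1 * b^-1).
Proof.
move=> gG Gn gN nN gR RG Nn nv Ra Rb.
pose c := n * b^-1 * n^-1.
have Gc : rist G (n v) c.
  by apply: rist_conj => //; apply: RG; apply: subgroupV.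
have ac : a * c = c * a.
  apply: rist_commute (RG _ Ra) Gc; first by rewrite tree_aut_size.
  by move/esym.
have Nbc : N (b * c).
  have -> : b * c = (b * n * b^-1) * n^-1 by rewrite /c; group_word.
  by apply: subgroupM => //; [apply: nN|apply: subgroupV].
have -> : a * b * a^-1 * b^-1 = (a * (b * c) * a^-1) * (b * c)^-1.
  have -> : a * (b * c) * a^-1 = a * b * (a^-1 * (a * c)) * a^-1 by group_word.
  by rewrite ac; group_word.
by apply: subgroupM => //; [apply: nN|apply: subgroupV].
Qed.

Definition generated_on (R : vertex d -> set (tree_aut d)) (S : set (vertex d)) :=
  generated (\bigcup_(v in S) R v).

Lemma generated_on_sub R R' S S' : (forall v, S v -> R v `<=` R' v) -> S `<=` S' ->
  generated_on R S `<=` generated_on R' S'.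
Proof.
move=> RR SS; apply: generated_sub; first exact: generated_subgroup.
move=> g [v Sv Rg]; apply: mem_generated; exists v; first exact: SS.
exact: RR Rg.
Qed.

Lemma generated_on_fix G k R S : is_subgroup G -> (forall v, R v `<=` rist G v) ->
  S `<=` level k ->
  generated_on R S `<=` pstab G (level k).
Proof.
move=> gG RG Sk; apply: generated_sub; first exact: pstab_subgroup.
move=> a [v Sv /RG Ra]; have [Ga aV] := Ra; split=> // w kw.
case: (boolP (prefix v w)) => [/prefixP[x e]|/aV //].
have := congr1 size e; rewrite size_cat kw (Sk _ Sv) => /eqP.
rewrite -{1}[k]addn0 eqn_add2l eq_sym => /nilP x0.
by rewrite e x0 cats0 (rist_fix Ra).
Qed.

Lemma generated_on_normalized G K k
    (R : vertex d -> set (tree_aut d)) (S : set (vertex d)) :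
  (forall g v, K g -> S v -> g v = v) ->
  (forall g v a, K g -> R v a -> R (g v) (g * a * g^-1)) ->
  S `<=` level k -> normalized (generated_on R S) K.
Proof.
move=> Kfix KR Sk; apply: normalized_generated => g a Kg [v Sv Ra].
by exists v => //; have := KR g v a Kg Ra; rewrite Kfix.
Qed.

(** Rigid stabilisers of distinct vertices of a level commute, so only the
commutators inside a single one of them matter. *)
Lemma derived_generated_on G k (R : vertex d -> set (tree_aut d)) (S : set (vertex d))
   (N : set (tree_aut d)) :
  is_subgroup G -> (forall v, is_subgroup (R v)) -> (forall v, R v `<=` rist G v) ->
  S `<=` level k -> is_subgroup N ->
  normalized N (generated_on R S) ->
  (forall v a b, S v -> R v a -> R v b -> N (a * b * a^-1 * b^-1)) ->
  derived (generated_on R S) `<=` N.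
Proof.
move=> gG gR RG Sk gN nN comm.
apply: derived_generated_sub => // a b [v Sv Ra] [w Sw Rb].
case: (pselect (v = w)) => [evw|nvw]; first by subst w; apply: comm Ra Rb.
rewrite (@rist_commute G v w a b) ?mulgK ?mulgV //; first exact: subgroup1.
- by rewrite (Sk _ Sv) (Sk _ Sw).
- exact: RG.
- exact: RG.
Qed.

Lemma rist_level_restrict G k : is_subgroup G ->
  forall v g, level k v -> rist_level G k g ->
  exists2 r, rist G v r & forall w, prefix v w -> g w = r w.
Proof.
move=> gG v g kv Dg.
suff sub : rist_level G k `<=`
    [set g | g v = v /\ exists2 r, rist G v r & forall w, prefix v w -> g w = r w].
  by have [] := sub g Dg.
apply: generated_sub; first split=> [|a b [av [r Rr ar]] [bv [s Rs bs]]|a [av [r Rr ar]]].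
- by split=> //; exists 1; [apply: (subgroup1 (rist_subgroup v gG))|].
- split; first by rewrite tree_aut_mulE bv av.
  exists (r * s); first by apply: (subgroupM (rist_subgroup v gG)).
  move=> w vw; rewrite !tree_aut_mulE -(bs w vw) ar //.
  by rewrite -bv tree_aut_prefix.
- have aVv : a^-1 v = v by rewrite -{1}av tree_autVK.
  split=> //; exists r^-1; first by apply: (subgroupV (rist_subgroup v gG)).
  move=> w vw; apply: (@tree_aut_inj _ r); rewrite tree_autKV -ar ?tree_autKV //.
  by rewrite -aVv tree_aut_prefix.
- move=> a [u ku Ra]; case: (pselect (u = v)) => [<-|nuv].
    by split; [apply: rist_fix Ra|exists a].
  have fixv w : prefix v w -> a w = w.
    move=> vw; apply: Ra.2; apply/negP; move: vw; rewrite !prefixE ku kv => /eqP ev /eqP eu.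
    by apply: nuv; rewrite -ev -eu.
  split; first by apply: fixv; apply: prefix_refl.
  by exists 1 => //; apply: (subgroup1 (rist_subgroup v gG)).
Qed.

End RigidStabilisers.

(** * Torsion *)

Section Torsion.
Variable d : nat.
Implicit Types (g h a b : tree_aut d) (u v w : vertex d) (G H K N : set (tree_aut d)).

(** The alternative to torsion in the subgroup induction: it is inherited by
overgroups, passes from a section of H to H, and rules out that H is cyclic. *)
Definition power_noncommutative (gT : groupType) (K : set gT) := forall n, 0 < n ->
  exists a b : gT, [/\ K a, K b & a ^+ n * b ^+ n <> b ^+ n * a ^+ n].

(** Take g with g^n moving a vertex v.  If b^n <> 1 for some b in the rigid
stabiliser of v, then b^n and its conjugate by g^n have different supports.  So,
if g^n commuted with all n-th powers, every rigid stabiliser of the level of v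
would have exponent n, and so would their product, which has finite index. *)
Lemma branch_power_noncommutative G : is_subgroup G -> branch G -> 0 < d ->
  ~ torsion G -> power_noncommutative G.
Proof.
move=> gG [trG _ fiG] d0 ntor n n0; apply: contrapT => comm; apply: ntor => g Gg.
have {}comm a b : G a -> G b -> a ^+ n * b ^+ n = b ^+ n * a ^+ n.
  by move=> Ga Gb; apply: contrapT => nab; apply: comm; exists a, b.
case: (pselect (g ^+ n = 1)) => [gn|/tree_aut_neq1[v gv]]; first by exists n.
have rexp r : rist G v r -> r ^+ n = 1.
  move=> Rr; apply: contrapT => rn.
  have Rrn : rist G v (r ^+ n) by apply: subgroupX => //; apply: rist_subgroup.
  have /(rist_commute _ _ Rrn) : rist G ((g ^+ n) v) (g ^+ n * r ^+ n * (g ^+ n)^-1).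
    by apply: rist_conj => //; apply: subgroupX.
  rewrite (comm g r Gg (Rr.1)) mulgK tree_aut_size => H.
  have [w rw] := tree_aut_neq1 rn; apply: rw.
  case: (boolP (prefix v w)) => vw; last exact: Rrn.2.
  have : rist G ((g ^+ n) v) (r ^+ n).
    have := rist_conj gG (subgroupX n gG Gg) Rrn.
    by rewrite (comm g r Gg (Rr.1)) mulgK.
  case=> _; apply; apply/negP; move: vw; rewrite !prefixE tree_aut_size => /eqP -> /eqP.
  by move/esym.
pose k := size v.
have Dexp r : rist_level G k r -> r ^+ n = 1.
  move=> Dr; apply: (@tree_aut_fix_large _ k) => // w kw.
  have kt : level k (take k w) by rewrite /level /= size_takel.
  have [s Rs rs] := rist_level_restrict gG kt Dr.
  have [h Gh hv] := trG k v _ erefl kt.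
  have : (h^-1 * s * h) ^+ n = 1.
    apply: rexp; have := rist_conj gG (subgroupV gG Gh) Rs.
    by rewrite invgK -hv tree_autVK.
  have -> : h^-1 * s * h = s ^ h by rewrite conjgE mulgA.
  rewrite -conjXg => /eqP; rewrite conjg_eq1 => /eqP sn.
  have pw : prefix (take k w) w by apply/prefixP; exists (drop k w); rewrite cat_take_drop.
  rewrite -[RHS](tree_aut_1E w) -sn.
  suff [] : (r ^+ n) w = (s ^+ n) w /\ prefix (take k w) ((s ^+ n) w) by [].
  elim: n {rexp comm gv n0 sn Dr} => [|m [IH1 IH2]]; first by [].
  rewrite !expgS !tree_aut_mulE IH1 rs //; split=> //.
  by rewrite -(rist_fix Rs) tree_aut_prefix.
have gD : is_subgroup (rist_level G k) by apply: generated_subgroup.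
have [m m0 Dm] := fin_index_power gG ((finite_indexP _ gD).1 (fiG k)) Gg.
by exists (m * n)%N; [rewrite muln_gt0 m0|rewrite expgnA Dexp].
Qed.

(** If the sections of H are all torsion then so is H; otherwise a single section
in the other alternative is enough. *)
Lemma inductive_torsion_or_noncommutative G : is_subgroup G -> branch G -> 0 < d ->
  inductive_class G [set H | subgroup_of H G /\ (torsion H \/ power_noncommutative H)].
Proof.
move=> gG bG d0; split=> [H []//||H L HL LG fHL [_ HX]|H fgH HS HX].
- split; split.
  + split; last by move=> _ ->; apply: subgroup1.
    by split=> [|x y -> ->|x ->] //; rewrite ?mulg1 ?invg1.
  + by left=> _ ->; exists 1%N.
  + by split.
  + by case: (pselect (torsion G)); [left|right; apply: branch_power_noncommutative].
- split=> //; case: HX => [tH|nH]; [left=> l Ll|right=> n n0].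
    have [k k0 Hlk] := fin_index_power LG.1 ((finite_indexP _ HL.1).1 fHL) Ll.
    have [m m0 lm] := tH _ Hlk.
    by exists (k * m)%N; [rewrite muln_gt0 k0|rewrite expgnA].
  by have [a [b [Ha Hb ab]]] := nH n n0; exists a, b; split=> //; apply: HL.2.
- have HG : subgroup_of H G by split; [exact: HS.1|move=> h /HS.2[]].
  split=> //.
  have Hfix h v : H h -> level 1 v -> h v = v by move=> /HS.2[_]; apply.
  case: (pselect (forall v, level 1 v -> torsion (tree_section v @` H))) => [tor|].
    left=> h Hh.
    have /choice[e eP] : forall x : 'I_d, exists n, 0 < n /\ tree_section [:: x] h ^+ n = 1.
      move=> x; have [||n n0 en] := tor [:: x] _ (tree_section [:: x] h) _ => //.
      by exists n.
    (* the order of h divides the product of the orders of its sections *)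
    exists (\prod_x e x)%N; first by rewrite prodn_cond_gt0 // => x _; case: (eP x).
    apply: tree_aut_eq_level1 => x; have hx := Hfix h [:: x] Hh erefl.
    split; first exact: tree_autX_fix.
    rewrite tree_sectionX // (bigD1 x) //= expgnA (eP x).2 expg1n.
    by rewrite tree_section1.
  move/existsNP => [v /not_implyP[kv ntor]]; right=> n n0.
  have [_ [//|nc]] := HX v kv.
  have [_ [_ [[a Ha <-] [b Hb <-] ab]]] := nc n n0.
  exists a, b; split=> // e; apply: ab.
  by rewrite -!tree_sectionX ?Hfix // -!tree_sectionM ?e // tree_autX_fix ?Hfix.
Qed.

Lemma subgroup_induction_torsion G : is_subgroup G -> branch G -> 0 < d ->
  subgroup_induction_property G -> torsion G.
Proof.
move=> gG bG d0 sip g Gg.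
have sub : subgroup_of (generated [set g]) G.
  by split; [exact: generated_subgroup|apply: generated_sub => // _ ->].
have gC := generated_subgroup [set g].
have Cg : generated [set g] g by apply: mem_generated.
have [_ [tor|nc]] := sip _ (inductive_torsion_or_noncommutative gG bG d0) _
   (cycle_finitely_generated g) sub; first exact: tor.
have comm a b : generated [set g] a -> generated [set g] b -> commute a b.
  move=> Ca Cb.
  have cg : generated [set g] `<=` [set c | commute g c].
    apply: generated_sub; last by move=> _ ->.
    by split=> [|x y|x]; [exact: commute1|exact: commuteM|exact: commuteV].
  suff : [set c | commute b c] a by move/commute_sym.
  apply: (generated_sub _ _ Ca); last by move=> _ ->; apply/commute_sym/cg.
  split=> [|x y|x]; [exact: commute1|exact: commuteM|exact: commuteV].
have [a [b [Ca Cb]]] := nc 1%N isT.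
by rewrite !expg1; case; apply: comm.
Qed.

Lemma derived_fin_index G U : is_subgroup G -> finitely_generated G -> torsion G ->
  subgroup_of U G -> fin_index U G -> fin_index (derived U) G.
Proof.
move=> gG fgG tG [gU UG] fU; apply: (fin_index_trans (generated_subgroup _) gU) => //.
apply: torsion_derived_fin_index; last exact: torsion_sub tG.
exact: fin_index_finitely_generated fgG _ _ _.
Qed.

(** By transitivity conjugates of one n <> 1 in N move every vertex of some level,
so N contains the derived subgroup of the rigid stabiliser of that level. *)
Lemma nontrivial_normal_fin_index G N : is_subgroup G -> finitely_generated G ->
  torsion G -> branch G -> subgroup_of N G -> normalized N G -> N <> [set 1] ->
  fin_index N G.
Proof.
move=> gG fgG tG [trG _ fiG] [gN NG] nN N1.
have [n Nn n1] : exists2 n, N n & n <> 1.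
  apply: contrapT => H; apply: N1; apply/seteqP; split=> [x Nx|_ ->]; last exact: subgroup1.
  by apply: contrapT => x1; apply: H; exists x.
have [v nv] := tree_aut_neq1 n1; pose k := size v.
have gD := generated_subgroup (\bigcup_(v in level k) rist G v).
have DG : rist_level G k `<=` G by apply: generated_sub => // g [w _ []].
have fD := (finite_indexP _ gD).1 (fiG k).
apply: (fin_index_sub _ _ (derived_fin_index gG fgG tG (conj gD DG) fD)) => //.
apply: (@derived_generated_on _ G k) => //.
- by move=> w; apply: rist_subgroup.
- by move=> w g.
- exact: (normalized_sub DG nN).
- move=> w a b kw Ra Rb; have [h Gh hv] := trG k v w erefl kw.
  apply: (@rist_commutator_mem _ G (rist G w) N (h * n * h^-1) w) => //.
  + by apply: subgroupM => //; [apply: subgroupM => //; apply: NG|apply: subgroupV].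
  + by apply: normalized_sub nN => g [].
  + exact: rist_subgroup.
  + exact: nN.
  + rewrite -hv !tree_aut_mulE tree_autVK => /(@tree_aut_inj _ h); exact: nv.
Qed.

End Torsion.

(** * Normal subgroups of finite-index subgroups of a branch group *)

Section NormalSubgroups.
Variable d : nat.
Implicit Types (g h a b : tree_aut d) (u v w : vertex d) (G H K N : set (tree_aut d)).

Lemma uniform_bound (I : eqType) (s : seq I) (E : nat -> I -> Prop) :
  exists m, forall p, p \in s -> (forall n, n <= m -> E n p) -> forall n, E n p.
Proof.
have /choice[f fP] p : exists n, E n p -> forall n, E n p.
  case: (pselect (forall n, E n p)) => [Ep|/existsNP[n nE]]; first by exists 0.
  by exists n.
exists (\max_(p <- s) f p) => p ps Ep; apply/fP/Ep.
exact: (leq_bigmax_seq _ ps).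
Qed.

(** The orbits of G0 on the levels are the classes of a relation between the
finitely many coset representatives, by transitivity of G.  This relation can only
shrink when the level grows, so it is eventually constant; from then on the
descendants of a vertex at a given level form part of one orbit. *)
Lemma orbits_stabilise G G0 : is_subgroup G -> level_transitive G -> 0 < d ->
  is_subgroup G0 -> fin_index G0 G ->
  exists m, forall u w, size u = size w -> m <= size u -> take m u = take m w ->
    exists2 g, G0 g & g u = w.
Proof.
move=> gG trG d0 gG0 /fin_index_reps[s [sG sP]].
pose ray n : vertex d := nseq n (Ordinal d0).
have rayE n m : n <= m -> take n (ray m) = ray n by move=> nm; rewrite /ray take_nseq.
(* inverses because G is covered by the left cosets t G0, while orbits need the
   right cosets G0 t^-1 *)
pose E n (p : tree_aut d * tree_aut d) :=
  exists2 g, G0 g & g (p.1^-1 (ray n)) = p.2^-1 (ray n).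
have Eanti n m p : n <= m -> E m p -> E n p.
  move=> nm [g Gg e]; exists g => //.
  by rewrite -(rayE n m nm) !tree_aut_take e.
have [m mP] := uniform_bound [seq (r, t) | r <- s, t <- s] E.
exists m => u w suw mu tuw.
have orb v : exists r g, [/\ r \in s, G0 g & g (r^-1 (ray (size v))) = v].
  have [|h Gh hv] := trG (size v) (ray (size v)) v _ erefl.
    by rewrite /level /= size_nseq.
  have [t ts Gth] := sP h^-1 (subgroupV gG Gh).
  exists t, (t^-1 * h^-1)^-1; split=> //; first exact: subgroupV.
  by rewrite -tree_aut_mulE; group_word.
have [r [g [rs Gg gr]]] := orb u; have [t [h [ts Gh ht]]] := orb w.
have Em : E m (r, t).
  exists (h^-1 * g); first by apply: subgroupM => //; apply: subgroupV.
  have e : h^-1 (take m u) = take m (t^-1 (ray (size u))).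
    by rewrite tuw -ht -suw -tree_aut_take tree_autVK.
  rewrite -(rayE m (size u) mu) tree_aut_mulE (tree_aut_take r^-1) (tree_aut_take g).
  by rewrite gr e tree_aut_take.
have [|k Gk /= kE] := mP (r, t) (allpairs_f _ rs ts) _ (size u).
  by move=> n nm; apply: Eanti nm Em.
exists (h * k * g^-1); first by apply: subgroupM => //; [apply: subgroupM|apply: subgroupV].
by rewrite !tree_aut_mulE -{1}gr tree_autVK kE suw.
Qed.

Lemma common_moving_level N (act : set (vertex d)) m : 0 < d ->
  (forall v, act v -> exists n w, [/\ N n, prefix v w & n w <> w]) ->
  exists2 k, m <= k & forall v, size v = m -> act v ->
    exists n w, [/\ N n, prefix v w, size w = k & n w <> w].
Proof.
move=> d0 actP.
have /choice[f fP] v : exists k, act v ->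
    exists n w, [/\ N n, prefix v w, size w = k & n w <> w].
  case: (pselect (act v)) => [/actP[n [w [Nn vw nw]]]|]; last by exists 0.
  by exists (size w) => _; exists n, w.
pose k := maxn m (\max_(t : m.-tuple 'I_d) f t).
exists k; first exact: leq_maxl.
move=> v /eqP vm av; have [n [w [Nn /prefixP[y e] sw nw]]] := fP v av.
have wk : size w <= k.
  by rewrite sw leq_max; apply/orP; right; apply: (leq_bigmax (Tuple vm)).
(* moving a vertex w moves all its descendants, in particular w ++ z *)
pose z := nseq (k - size w) (Ordinal d0); exists n, (w ++ z); split=> //.
- by rewrite e -catA prefix_prefix.
- by rewrite size_cat size_nseq subnKC.
- by move/(tree_aut_fix_take (size w)); rewrite take_size_cat.
Qed.

(** Let D be the rigid stabiliser of level k.  For a in the rigid stabiliser of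
v and b in both C and D, the commutator [a, b] lies in C since C is normal, and
it is supported below v since b fixes v.  Hence the group generated by the
intersections of C with the rigid stabilisers contains the derived subgroup of
the intersection of C and D. *)
Lemma rigid_core_fin_index G C k : is_subgroup G -> finitely_generated G -> torsion G ->
  branch G -> subgroup_of C G -> fin_index C G -> normalized C G ->
  fin_index (generated_on (fun v => C `&` rist G v) (level k)) G.
Proof.
move=> gG fgG tG [_ _ fiG] [gC CG] fC nC.
set R := fun v => _; pose D := rist_level G k.
have gD : is_subgroup D by apply: generated_subgroup.
have gR v : is_subgroup (R v) by apply: subgroupI => //; apply: rist_subgroup.
have DG : D `<=` G by apply: generated_sub => // g [w _ []].
have Dfix g v : D g -> level k v -> g v = v.
  move=> Dg; have [_] : pstab G (level k) g; last by apply.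
  by apply: (@generated_on_fix _ G k (rist G) (level k)) => // w x.
have RC g v a : G g -> R v a -> R (g v) (g * a * g^-1).
  by move=> Gg [Ca Ra]; split; [apply: nC|apply: rist_conj].
have nDR : normalized (generated_on R (level k)) D.
  by apply: (@generated_on_normalized _ G _ k) => // g v a /DG; apply: RC.
have fD := (finite_indexP _ gD).1 (fiG k).
have fW := fin_index_inter fC fD.
have gW := subgroupI gC gD.
have WG : C `&` D `<=` G by move=> c [/CG].
have := derived_fin_index gG fgG tG (conj gW WG) fW.
apply: fin_index_sub => //; apply: generated_sub; first exact: generated_subgroup.
move=> _ [a [b [[_ Da] [Cb Db] ->]]].
suff sub : D `<=` [set a | D a /\ generated_on R (level k) (a * b * a^-1 * b^-1)].
  by have [] := sub a Da.
apply: generated_sub; first by apply: commutator_subgroup => //; apply: generated_subgroup.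
move=> r [v kv Rr]; split; first by apply: mem_generated; exists v.
apply: mem_generated; exists v => //; split.
  have -> : r * b * r^-1 * b^-1 = (r * b * r^-1) * b^-1 by [].
  by apply: subgroupM => //; [apply: nC => //; apply: Rr.1|apply: subgroupV].
have -> : r * b * r^-1 * b^-1 = r * (b * r^-1 * b^-1) by group_word.
have gRv := rist_subgroup v gG.
apply: (subgroupM gRv) => //; rewrite -(Dfix b v Db kv).
by apply: rist_conj => //; [apply: DG|apply: subgroupV].
Qed.

(** Let S be the set of vertices of level k below the vertices of level m where N
is active.  By the choice of m and k, every vertex of S is moved by N.  So N
contains the commutators of the rigid stabilisers R w for w in S, while N acts
trivially below the other vertices of level k.  Therefore N has the same
intersection with D1 = [D, D], where D is the product of all R w, as the fixator F
of these other subtrees; and both F and D1 are closed. *)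
Lemma normal_closed G G0 N : is_subgroup G -> finitely_generated G -> torsion G ->
  branch G -> 0 < d -> subgroup_of G0 G -> fin_index G0 G ->
  subgroup_of N G0 -> normalized N G0 -> prof_closed G N.
Proof.
move=> gG fgG tG bG d0 [gG0 G0G] fG0 [gN NG0] nN.
have [trG _ _] := bG.
have [m mP] := orbits_stabilise gG trG d0 gG0 fG0.
pose act v := exists n w, [/\ N n, prefix v w & n w <> w].
have [k mk kP] := @common_moving_level N act m d0 (fun v => id).
pose S := [set w : vertex d | size w = k /\ act (take m w)].
pose S' := [set w : vertex d | size w = k /\ ~ act (take m w)].
have Sk : S `<=` level k by move=> w [].
have S'k : S' `<=` level k by move=> w [].
(* a vertex w' below the same vertex of level m is moved by N; some g in G0 takes
   it to w and conjugates N to N *)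
have moved w : S w -> exists2 n, N n & n w <> w.
  move=> [wk aw]; have [|n [w' [Nn pw' sw' nw']]] := kP _ _ aw.
    by rewrite size_takel ?wk.
  have [|||g Gg gw] := mP w' w; rewrite ?sw' ?wk //.
    move: pw'; rewrite prefixE => /eqP; rewrite size_takel ?wk //.
  exists (g * n * g^-1); first exact: nN.
  rewrite -gw !tree_aut_mulE tree_autVK => /(@tree_aut_inj _ g); exact: nw'.
pose C := core G0 G.
have gC : is_subgroup C by apply: core_subgroup.
have CG : C `<=` G by move=> x [].
have CG0 : C `<=` G0 by apply: core_sub.
have fC : fin_index C G by apply: core_fin_index.
have nC : normalized C G by apply: core_normal.
pose R v := C `&` rist G v.
have gR v : is_subgroup (R v) by apply: subgroupI => //; apply: rist_subgroup.
have RR v : R v `<=` rist G v by move=> x [].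
have RC v : R v `<=` C by move=> x [].
pose D T := generated_on R T.
have gD T : is_subgroup (D T) by apply: generated_subgroup.
have DC T : D T `<=` C by apply: generated_sub => // x [v _ /RC].
have Dfix T g v : T `<=` level k -> D T g -> level k v -> g v = v.
  move=> Tk Dg; have [_] : pstab G (level k) g; last by apply.
  by apply: (@generated_on_fix _ G k R T).
have nDD T : T `<=` level k -> normalized (D T) (D (level k)).
  move=> Tk; apply: (@generated_on_normalized _ G _ k) => //.
    by move=> g v Dg /Tk; apply: Dfix Dg.
  move=> g v a /DC/CG Gg [Ca Ra]; split; first exact: nC.
  exact: rist_conj.
have nND : normalized N (D (level k)) by apply: normalized_sub nN => g /DC/CG0.
have fD : fin_index (D (level k)) G by apply: rigid_core_fin_index.
pose D1 := derived (D (level k)).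
have gD1 : is_subgroup D1 by apply: generated_subgroup.
have DkG : D (level k) `<=` G by move=> x /DC/CG.
have D1G : D1 `<=` G by move=> x /(derived_sub (gD _))/DkG.
have fD1 : fin_index D1 G.
  by apply: derived_fin_index => //; split.
(* generators over distinct vertices commute, so only commutators inside a single
   R v matter: they are in N for v in S, and in D S' otherwise *)
have D1sub : D1 `<=` prod_set (N `&` D S) (D S').
  have nNS : normalized (N `&` D S) (D (level k)) by apply: normalizedI => //; apply: nDD.
  have SS : D S `<=` D (level k) by apply: generated_on_sub => // v _ r.
  apply: (@derived_generated_on _ G k) => //.
  - apply: prod_set_subgroup => //; first exact: subgroupI.
    apply: normalized_sub (nDD _ S'k) => x [_]; exact: SS.
  - by apply: normalized_prod_set => //; apply: nDD.
  - move=> v a b kv Ra Rb; case: (pselect (act (take m v))) => av.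
      have Sv : S v by split.
      apply: prod_set_subl => //; split; last first.
        apply: mem_generated; exists v => //.
        by repeat apply: subgroupM => //; apply: subgroupV.
      have [n Nn nv] := moved v Sv.
      apply: (@rist_commutator_mem _ G (R v) N n v) => //.
      + by apply/G0G/NG0.
      + by apply: normalized_sub nN => x /RC/CG0.
    apply: prod_set_subr; first exact: subgroupI.
    apply: mem_generated; exists v; first by split.
    by repeat apply: subgroupM => //; apply: subgroupV.
pose F := pstab G [set w : vertex d | k <= size w /\ ~ act (take m w)].
have NF : N `<=` F.
  move=> n Nn; split; first exact/G0G/NG0.
  move=> w [kw nact]; apply: contrapT => nw; apply: nact; exists n, w; split=> //.
  by apply/prefixP; exists (drop m w); rewrite cat_take_drop.
have FN : F `&` D1 = N `&` D1.
  apply/seteqP; split=> x [Fx D1x]; split=> //; last exact: NF.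
  have [p [Np _] Dq] := D1sub x D1x.
  suff -> : x = p by [].
  apply: (@mulgI _ p^-1); rewrite mulVg.
  apply: (@tree_aut_fix_large _ k) => // w kw.
  (* p^-1 x is in D S', so acts trivially below S; below the other vertices of
     level k both x, being in F, and p, being in N, act trivially *)
  case: (pselect (act (take m w))) => aw; last first.
    rewrite tree_aut_mulE; have [_ ->//] := Fx.
    have /NF[_ pw] := Np; rewrite -{1}(pw w) ?tree_autVK //.
  have sub : D S' `<=` pstab G [set w].
    apply: generated_sub; first exact: pstab_subgroup.
    move=> r [v [vk nav] [Cr [Gr rV]]]; split=> // _ ->; apply: rV.
    apply/negP; rewrite prefixE vk => /eqP e; apply: nav.
    by rewrite -e take_takel.
  by have [_ ->] := sub _ Dq.
apply: (@prof_closed_fin_index _ _ (N `&` D1)) => //.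
- by move=> x /NG0/G0G.
- rewrite setIC; apply: (fin_index_restrict gN _ fD1); by move=> x /NG0/G0G.
- rewrite -FN; apply: prof_closedI => //; first exact: pstab_closed.
  by apply: fin_index_closed.
Qed.

End NormalSubgroups.

(** * Finitely generated subgroups are closed *)

Section Separability.
Variable d : nat.
Implicit Types (g h a b : tree_aut d) (u v w : vertex d) (G H K N : set (tree_aut d)).

(** The property proved by subgroup induction.  Quantifying over H0 makes it pass
to finite-index overgroups. *)
Definition normal_subgroups_closed G H := forall H0 N, subgroup_of H0 H -> fin_index H0 H ->
  subgroup_of N H0 -> normalized N H0 -> prof_closed G N.

(** The elements of L that agree with some element of N on the coordinates in s:
for s empty this is L, for s the list of all letters and L the stabiliser of the
first level it is N. *)
Definition sections_match (L N : set (tree_aut d)) (s : seq 'I_d) := [set g | L g /\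
  exists2 n, N n & forall x, x \in s -> tree_section [:: x] g = tree_section [:: x] n].

(** Suppose that g agrees with n0 in N on s, but with no element of N on x :: s.
The kernel K of N on the coordinates in s is normal in H0, so its image under the
section phi at x is closed and phi (n0^-1 g) is separated from it by a
finite-index subgroup V, normalised by the sections of H0.  The elements of N with
section in V form a finite-index subgroup of N to which the induction hypothesis
applies. *)
Lemma sections_match_closed G H H0 N (s : seq 'I_d) :
  is_subgroup G -> self_similar G ->
  subgroup_of H (pstab G (level 1)) ->
  (forall v, level 1 v -> normal_subgroups_closed G (tree_section v @` H)) ->
  subgroup_of H0 H -> fin_index H0 H -> subgroup_of N H0 -> normalized N H0 ->
  prof_closed G (sections_match (pstab G (level 1)) N s).
Proof.
move=> gG ssG [gH HL] HX [gH0 H0H] fH0.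
set L := pstab G (level 1) in HL *.
have gL : is_subgroup L by apply: pstab_subgroup.
have LG : L `<=` G by move=> g [].
have fL : fin_index L G by apply: fin_index_pstab_level.
have cL : prof_closed G L by apply: fin_index_closed.
have H0L : H0 `<=` L by move=> h /H0H/HL.
have secM (x : 'I_d) a b : L a -> L b ->
    tree_section [:: x] (a * b) = tree_section [:: x] a * tree_section [:: x] b.
  by move=> _ [_ Lb]; apply: tree_sectionM; apply: Lb.
have secV (x : 'I_d) a : L a -> tree_section [:: x] a^-1 = (tree_section [:: x] a)^-1.
  by move=> [_ La]; apply: tree_sectionV; apply: La.
elim: s N => [|x s IH] N [gN NH0] nN.
  suff -> : sections_match L N [::] = L by [].
  apply/seteqP; split=> [g []//|g Lg]; split=> //.
  by exists 1; [apply: subgroup1|].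
have NL : N `<=` L by move=> n /NH0/H0L.
move=> g Gg ng.
case: (pselect (L g)) => [Lg|nLg]; last first.
  by have [U [sU fU UL]] := cL g Gg nLg; exists U; split=> // u Uu [/(UL u Uu)].
case: (pselect (sections_match L N s g)) => [[_ [n0 Nn0 e0]]|nsg]; last first.
  have [U [sU fU UL]] := IH N (conj gN NH0) nN g Gg nsg.
  exists U; split=> // u Uu [Lgu [n Nn e]]; apply: (UL u Uu); split=> //.
  by exists n => // y ys; apply: e; rewrite inE ys orbT.
pose phi := tree_section [:: x].
pose K := [set n | N n /\ forall y, y \in s -> tree_section [:: y] n = 1].
have gK : is_subgroup K.
  split=> [|a b [Na ea] [Nb eb]|a [Na ea]].
  - by split; [apply: subgroup1|move=> y _; apply: tree_section1].
  - split; first exact: subgroupM.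
    by move=> y ys; rewrite secM ?ea ?eb ?mulg1 //; apply: NL.
  - split; first exact: subgroupV.
    by move=> y ys; rewrite secV ?ea ?invg1 //; apply: NL.
have KN : K `<=` N by move=> n [].
have nK : normalized K H0.
  move=> h n Hh [Nn en]; split; first exact: nN.
  move=> y ys; have [Lh Ln] := (H0L h Hh, NL n Nn).
  have [LhV Lhn] := (subgroupV gL Lh, subgroupM gL Lh Ln).
  by rewrite !secM // secV // en // mulg1 mulgV.
have phiM A : A `<=` L -> forall a b, A a -> A b -> phi (a * b) = phi a * phi b.
  by move=> AL a b Aa Ab; apply: secM; apply: AL.
have gimg A : is_subgroup A -> A `<=` L -> is_subgroup (phi @` A).
  by move=> gA AL; apply: image_subgroup => //; apply: phiM.
have phiG a : L a -> G (phi a) by move=> /LG La; apply: (ssG [:: x]); exists a.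
have imgG A : A `<=` L -> phi @` A `<=` G by move=> AL _ [a /AL/phiG + <-].
have nphiK : normalized (phi @` K) (phi @` H0).
  move=> _ _ [h Hh <-] [k Kk <-]; exists (h * k * h^-1); first exact: nK.
  have [Lh Lk] := (H0L h Hh, NL k (KN k Kk)).
  have [LhV Lhk] := (subgroupV gL Lh, subgroupM gL Lh Lk).
  by rewrite /phi !secM // secV.
have KL : K `<=` L by move=> k /KN/NL.
have cK : prof_closed G (phi @` K).
  apply: (HX [:: x] erefl (phi @` H0)) => //.
  - by split; [exact: gimg|move=> _ [h /H0H Hh <-]; exists h].
  - by apply: fin_index_image => //; apply: phiM.
  - split; first exact: gimg.
    by move=> _ [k /KN/NH0 Hk <-]; exists k.
have Ln0 := NL _ Nn0; have Ln0V := subgroupV gL Ln0.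
have Lg' : L (n0^-1 * g) by apply: subgroupM.
have nKg : ~ (phi @` K) (phi (n0^-1 * g)).
  move=> [k Kk ek]; apply: ng; split=> //; exists (n0 * k).
    by apply: subgroupM => //; apply: KN.
  move=> y; rewrite inE => /orP[/eqP->|ys].
    have -> : tree_section [:: x] (n0 * k) = phi n0 * phi k by apply: secM => //; apply: KL.
    by rewrite ek /phi secM // secV // mulVKg.
  by rewrite secM ?(Kk.2 y ys) ?mulg1 ?e0 //; apply: KL.
have [C [[gC CG] fC nC nVg]] :=
  prof_closed_sep gG (gimg K gK KL) (imgG K KL) cK (phiG _ Lg') nKg.
set V := prod_set _ C in nVg.
have gV : is_subgroup V.
  apply: prod_set_subgroup => //; first exact: gimg.
  exact: normalized_sub (imgG K KL) nC.
have nV : normalized V (phi @` H0).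
  apply: normalized_prod_set => //; exact: normalized_sub (imgG H0 H0L) nC.
have CV : C `<=` V by apply: prod_set_subr; apply: gimg.
(* phi^-1(V) has finite index in G, hence the intersection of N with it is a
   finite-index subgroup of N, still normal in H0 *)
pose W := [set a | L a /\ V (phi a)].
have gW : is_subgroup W.
  split=> [|a b [La Va] [Lb Vb]|a [La Va]].
  - by split; [apply: subgroup1|rewrite /phi tree_section1; apply: subgroup1].
  - by split; [apply: subgroupM|rewrite /phi secM //; apply: subgroupM].
  - by split; [apply: subgroupV|rewrite /phi secV //; apply: subgroupV].
have WG : W `<=` G by move=> a [/LG].
have fWL : fin_index W L.
  have [I [F FC]] := fC; exists I, (fun a => F (phi a)) => a b La Lb e.
  have LVa := subgroupV gL La.
  split; first by apply: subgroupM.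
  by rewrite /phi secM // secV //; apply/CV/FC => //; apply: phiG.
have fW : fin_index W G by apply: fin_index_trans fWL fL.
have cW : prof_closed G W by apply: fin_index_closed.
have nW : normalized W H0.
  move=> h a Hh [La Va]; have Lh := H0L h Hh; have LhV := subgroupV gL Lh.
  have Lha := subgroupM gL Lh La.
  split; first exact: subgroupM.
  by rewrite /phi !secM // secV //; apply: nV => //; exists h.
have gM := subgroupI gN gW.
have MH0 : N `&` W `<=` H0 by move=> n [/NH0].
have cM := IH (N `&` W) (conj gM MH0) (normalizedI nN nW).
have fM : fin_index (N `&` W) N.
  by rewrite setIC; apply: fin_index_restrict fW => // n /NL/LG.
have [r [rN rP]] := fin_index_reps fM.
(* the union of the E t contains the set to be proved closed, and avoids g *)
pose E t := [set h | (sections_match L (N `&` W) s `&` W) (t^-1 * h)].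
have cE : prof_closed G [set h | exists2 t, t \in r & E t h].
  apply: prof_closed_union => // t /rN/NL/LG Gt.
  by apply: prof_closed_lcoset => //; apply: prof_closedI.
have [|U [sU fU UE]] := cE g Gg.
  move=> [t /rN Nt [[_ [n1 [Nn1 [_ Vn1]] e1]] [_ Vtg]]]; apply: nVg.
  have [Lt Ln1] := (NL t Nt, NL n1 Nn1).
  have [LtV Ln1V] := (subgroupV gL Lt, subgroupV gL Ln1).
  have Ltg := subgroupM gL LtV Lg.
  have Kk : K (n0^-1 * (t * n1)).
    split; first by apply: subgroupM; [|apply: subgroupV|apply: subgroupM].
    move=> y ys; rewrite secM ?(secM _ t n1) ?secV //; last exact: subgroupM.
    by rewrite -e0 // -e1 // (secM _ t^-1 g) // secV // mulVKg mulVg.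
  have Lk := KL _ Kk.
  have -> : n0^-1 * g = n0^-1 * (t * n1) * (n1^-1 * (t^-1 * g)) by group_word.
  rewrite /phi secM ?(secM _ n1^-1) ?secV //; last exact: subgroupM.
  apply: subgroupM => //.
    by apply: prod_set_subl => //; exists (n0^-1 * (t * n1)).
  by apply: subgroupM => //; apply: subgroupV.
exists U; split=> // u Uu [Lgu [n Nn en]]; apply: (UE u Uu).
have [t tr [Ntn Wtn]] := rP n Nn; exists t => //.
have Lt := NL t (rN t tr); have LtV := subgroupV gL Lt; have Ln := NL n Nn.
have Ltgu := subgroupM gL LtV Lgu.
split; split=> //.
- exists (t^-1 * n) => // y ys; rewrite secM // [RHS]secM // en //.
  by rewrite inE ys orbT.
- rewrite /phi secM // en ?mem_head // -secM //; exact: Wtn.2.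
Qed.

(** For an overgroup K of finite index of H, with N normal in K0, the group N is a
finite union of cosets of its intersection with H, which is normal in the
intersection of K0 and H. *)
Lemma normal_subgroups_closed_inductive G : is_subgroup G -> finitely_generated G ->
  torsion G -> branch G -> self_similar G -> 0 < d ->
  inductive_class G [set H | subgroup_of H G /\ normal_subgroups_closed G H].
Proof.
move=> gG fgG tG bG ssG d0; split=> [H []//||H K HK KG fHK [_ HX]|H fgH HL HX].
- split; split.
  + split; last by move=> _ ->; apply: subgroup1.
    by split=> [|x y -> ->|x ->] //; rewrite ?mulg1 ?invg1.
  + move=> H0 N [_ H1] _ [gN NH0] _ g Gg nNg.
    have [|v gv] := @tree_aut_neq1 _ g.
      by move=> e; apply: nNg; rewrite e; apply: subgroup1.
    have [U [sU fU Uv]] := fin_index_vertex_stab v gG.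
    exists U; split=> // u Uu /NH0/H1 e; apply: gv.
    by have := congr1 (fun f : tree_aut d => f v) e; rewrite tree_aut_mulE Uv.
  + by split.
  + by move=> H0 N H0G fH0 NH0 nN; apply: (normal_closed gG fgG tG bG d0 H0G fH0).
- split=> // K0 N [gK0 K0K] fK0 [gN NK0] nN.
  have [gH HsK] := HK; have fHK' := (finite_indexP _ gH).1 fHK.
  have NK : N `<=` K by move=> n /NK0/K0K.
  apply: (@prof_closed_fin_index _ _ (H `&` N)) => //.
  + by move=> n /NK; apply: KG.2.
  + exact: fin_index_restrict fHK'.
  + apply: (HX (K0 `&` H)).
    * by split; [apply: subgroupI|move=> h []].
    * by apply: fin_index_restrict fK0.
    * by split; [apply: subgroupI|move=> h [Hh /NK0]].
    * move=> x y [K0x Hx] [Hy Ny]; split; last exact: nN.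
      by apply: subgroupM => //; [apply: subgroupM|apply: subgroupV].
- have HG : subgroup_of H G by split; [exact: HL.1|move=> h /HL.2[]].
  split=> // H0 N H0H fH0 NH0 nN.
  have := @sections_match_closed G H H0 N (enum 'I_d) gG ssG HL _ H0H fH0 NH0 nN.
  have -> : sections_match (pstab G (level 1)) N (enum 'I_d) = N.
    apply/seteqP; split=> [h [[_ Lh] [n Nn e]]|n Nn].
      suff -> : h = n by [].
      have [_ Ln] := HL.2 _ (H0H.2 _ (NH0.2 _ Nn)).
      apply: tree_aut_eq_level1 => x; rewrite Lh ?Ln //; split=> //.
      by apply: e; rewrite mem_enum.
    split; last by exists n.
    exact: HL.2 _ (H0H.2 _ (NH0.2 _ Nn)).
  by apply=> v /HX[].
Qed.

Lemma finitely_generated_closed G K : is_subgroup G -> finitely_generated G ->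
  torsion G -> branch G -> self_similar G -> 0 < d -> subgroup_induction_property G ->
  finitely_generated K -> subgroup_of K G -> prof_closed G K.
Proof.
move=> gG fgG tG bG ssG d0 sip fgK KG.
have [_ nc] := sip _ (normal_subgroups_closed_inductive gG fgG tG bG ssG d0) K fgK KG.
have [gK _] := KG; have KK : subgroup_of K K by split.
apply: (nc K K) => //; first exact: fin_index_refl.
by move=> x y Kx Ky; apply: subgroupM => //; [apply: subgroupM|apply: subgroupV].
Qed.

End Separability.

(** * The main theorem *)

Theorem theorem3p16 (d : nat) (d_ge2 : (2 <= d)%N)
  (G : set (tree_aut d)) (G_subgroup : is_subgroup G)
  (G_fg : finitely_generated G) (G_selfsimilar : self_similar G)
  (G_branch : branch G) (G_sip : subgroup_induction_property G)
  (G_frattini : frattini_fi G <> [set 1])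
  (H : groupType)
  (H_commensurable : exists K : set (tree_aut d),
     [/\ finitely_generated K, subgroup_of K G & commensurable [set: H] K]) :
  forall M : set H, maximal_subgroup M [set: H] -> finite_index M [set: H].
Proof.
have d_gt0 : 0 < d by apply: leq_trans d_ge2.
have tG := subgroup_induction_torsion G_subgroup G_branch d_gt0 G_sip.
have gPhi := frattini_fi_subgroup G_subgroup.
have PhiG : frattini_fi G `<=` G by move=> g [].
have fPhi : fin_index (frattini_fi G) G.
  apply: nontrivial_normal_fin_index => //; exact: frattini_fi_normal.
have lerf L := @finitely_generated_closed d G L G_subgroup G_fg tG G_branch
  G_selfsimilar d_gt0 G_sip.
move=> M maxM; have [[gM _] _ _] := maxM; apply/(finite_indexP _ gM).
have [K [fgK [gK KG] [A [B [[[gA _] fA] [[gB BK] fB] iso]]]]] := H_commensurable.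
have [f [[fAB finj fsurj] fM]] := iso.
have {}fA := (finite_indexP _ gA).1 fA; have {}fB := (finite_indexP _ gB).1 fB.
pose B1 := B `&` frattini_fi G.
have gB1 : is_subgroup B1 by apply: subgroupI.
have B1K : B1 `<=` K by move=> g [/BK].
have fB1 : fin_index B1 K.
  by apply: fin_index_inter => //; apply: fin_index_sub fPhi.
have fgB1 := fin_index_finitely_generated fgK gB1 B1K fB1.
have preim_subgroup P : is_subgroup P -> is_subgroup [set h | A h /\ P (f h)].
  move=> gP; split=> [|x y [Ax Px] [Ay Py]|x [Ax Px]].
  - by split; [apply: subgroup1|rewrite (partial_hom1 gA fM); apply: subgroup1].
  - by split; [apply: subgroupM|rewrite fM //; apply: subgroupM].
  - by split; [apply: subgroupV|rewrite (partial_homV gA fM) //; apply: subgroupV].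
have preim_fin_index P Q : is_subgroup Q -> fin_index P Q ->
    fin_index [set h | A h /\ P (f h)] [set h | A h /\ Q (f h)].
  move=> gQ [I [F FP]]; exists I, (F \o f) => x y [Ax Qx] [Ay Qy] e.
  split; first by apply: subgroupM => //; apply: subgroupV.
  by rewrite fM ?(partial_homV gA fM) //; [apply: FP|apply: subgroupV].
(* the copy in H of the subgroup B1 of Phi_F(G) *)
pose H0 := [set h | A h /\ B1 (f h)].
have fH0 : fin_index H0 setT.
  apply: (fin_index_trans (preim_subgroup _ gB1) gA) => //.
  apply: (fin_index_sub _ _ (preim_fin_index B1 B gB _)) => //.
    by move=> h Ah; split=> //; apply: fAB.
  by apply: fin_index_sub fB1.
apply: fin_index_overgroup_maximal fH0 _ maxM; first exact: preim_subgroup.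
move=> P [gP PH0] nP.
have gfP : is_subgroup (f @` P).
  by apply: image_subgroup => // x y /PH0[Ax _] /PH0[Ay _]; apply: fM.
have nfP : ~ B1 `<=` f @` P.
  move=> B1P; apply: nP => h [Ah B1h]; have [p Pp ep] := B1P _ B1h.
  suff -> : h = p by [].
  apply: finj; rewrite ?inE //; by case: (PH0 p Pp).
have fPB1 : subgroup_of (f @` P) B1 by split=> // _ [p /PH0[_ B1p] <-].
have B1G : subgroup_of B1 G by split=> // g /B1K/KG.
have B1Phi : B1 `<=` frattini_fi G by move=> g [].
have [L [gL PL fL nL]] :=
  proper_subgroup_fin_index G_subgroup tG lerf B1G B1Phi fgB1 fPB1 nfP.
have gLB : is_subgroup (L `&` B1) by apply: subgroupI.
exists [set h | A h /\ (L `&` B1) (f h)]; split.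
- by split; [apply: preim_subgroup|move=> h [Ah [_ B1h]]].
- by move=> p Pp; have [Ap B1p] := PH0 p Pp; split=> //; split=> //; apply: PL; exists p.
- by apply: preim_fin_index => //; apply: fin_index_restrict fL.
- move=> sub; apply: nL => b B1b; have [a Aa ea] := fsurj b (B1b.1).
  by have [|_ [Lfa _]] := sub a; [split; rewrite // ea|rewrite -ea].
Qed.
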